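(* Let $V$ be an open subset of $\mathbb R^d$ and $\mathbf f=(f_1,\dots,f_n):V\to\mathbb R^n$ a $C^l$ map which is nondegenerate at $x_0\in V$. Put $k=n+1$. Then there exists a neighborhood $B\subset V$ of $x_0$ such that for every $\gamma>0$, $$\sum_{t=1}^\infty\big|\{x\in B: g_tL_{\mathbf f(x)}\mathbb Z^k\in\Omega_{e^{-\gamma t}}\}\big|<\infty,$$ where $|\cdot|$ is Lebesgue measure on $\mathbb R^d$.
   Context: $\|\mathbf x\|=\max_i|x_i|$ on $\mathbb R^k$. $\Omega$ is the space of unimodular lattices in $\mathbb R^k$ ($\cong SL_k(\mathbb R)/SL_k(\mathbb Z)$), and for $\varepsilon>0$, $\Omega_\varepsilon=\{\Lambda\in\Omega:\|\mathbf v\|<\varepsilon\text{ for some }\mathbf v\in\Lambda\setminus\{0\}\}$. Here $g_t=\operatorname{diag}(e^t,e^{-t/n},\dots,e^{-t/n})\in SL_k(\mathbb R)$ and, for $\mathbf y\in\mathbb R^n$, $L_{\mathbf y}=\begin{pmatrix}1&\mathbf y^T\\0&I_n\end{pmatrix}$. The map $\mathbf f$ is nondegenerate at $x_0$ if $\mathbb R^n$ is spanned by the partial derivatives of $\mathbf f$ at $x_0$ of orders $1$ through $l$. *)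

(* Defs.v *)
From HB Require Import structures.
From mathcomp Require Import all_boot all_order all_algebra.
From mathcomp Require Import all_classical all_reals all_analysis.
Set Implicit Arguments. Unset Strict Implicit. Unset Printing Implicit Defensive.
Import Order.TTheory GRing.Theory Num.Theory.
Import numFieldNormedType.Exports.
Local Open Scope classical_set_scope.
Local Open Scope ring_scope.

Section Defs.
Variable R : realType.

Definition box (d : nat) (a b : 'rV[R]_d) : set 'rV[R]_d :=
  [set x | forall i, a 0 i <= x 0 i <= b 0 i].
Definition box_vol (d : nat) (a b : 'rV[R]_d) : R :=
  \prod_(i < d) (b 0 i - a 0 i).
(* Lebesgue (outer) measure on R^d: infimum of total volumes of countable
   covers by boxes; it coincides with Lebesgue measure on measurable sets. *)
Definition lebesgue_d (d : nat) (A : set 'rV[R]_d) : \bar R :=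
  ereal_inf [set r | exists (a b : nat -> 'rV[R]_d),
     [/\ (forall k i, a k 0 i <= b k 0 i),
          A `<=` \bigcup_k box (a k) (b k) &
          r = (\sum_(0 <= k <oo) ((box_vol (a k) (b k))%:E))%E]].

Definition unitv (d : nat) (i : 'I_d) : 'rV[R]_d := delta_mx 0 i.

Definition pderiv (d n : nat) (s : seq 'I_d) (f : 'rV[R]_d -> 'rV[R]_n)
  : 'rV[R]_d -> 'rV[R]_n :=
  foldr (fun i g => 'D_(unitv i) g) f s.

Definition Cl_on (d n l : nat) (V : set 'rV[R]_d) (f : 'rV[R]_d -> 'rV[R]_n)
  : Prop :=
  (forall (s : seq 'I_d) (i : 'I_d) x, (size s < l)%N -> V x ->
      derivable (pderiv s f) x (unitv i)) /\
  (forall (s : seq 'I_d) x, (size s <= l)%N -> V x ->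
      {for x, continuous (pderiv s f)}).

Definition nondegenerate_at (d n l : nat) (f : 'rV[R]_d -> 'rV[R]_n)
  (x0 : 'rV[R]_d) : Prop :=
  (\sum_(j < l) \sum_(s : j.+1.-tuple 'I_d) <[pderiv s f x0]>)%VS = fullv.

Definition supnorm (k : nat) (v : 'cV[R]_k) : R := \big[Num.max/0]_(i < k) `|v i 0|.

(* The lattice A Z^k (A : 'M_k) lies in Omega_eps: it has a nonzero
   vector of sup norm < eps. *)
Definition in_Omega (k : nat) (eps : R) (A : 'M[R]_k) : Prop :=
  exists m : 'cV[int]_k, m != 0 /\ supnorm (A *m map_mx intr m) < eps.

Definition gt (n : nat) (t : R) : 'M[R]_(n.+1) :=
  \matrix_(i, j) (if i == j then (if i == ord0 then expR t else expR (- t / n%:R))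
                  else 0).

Definition Ly (n : nat) (y : 'rV[R]_n) : 'M[R]_(n.+1) :=
  block_mx (1 : 'M[R]_1) y 0 (1%:M : 'M[R]_n).

End Defs.

(* Main.v *)
Require Import Defs.
From HB Require Import structures.
From mathcomp Require Import all_boot all_order all_algebra.
From mathcomp Require Import all_classical all_reals all_analysis.
From mathcomp Require Import ring lra.
Import Order.TTheory GRing.Theory Num.Theory.
Import numFieldNormedType.Exports.
Set Implicit Arguments. Unset Strict Implicit. Unset Printing Implicit Defensive.
Local Open Scope classical_set_scope.
Local Open Scope ring_scope.

(* Kleinbock and Margulis's quantitative nondivergence, with M-adic subdivisions
   of cubes in place of the Besicovitch covering theorem.

   By nondegeneracy an affine combination g = c0 + c . f is, on every small cube
   Q near x0, close to a polynomial relative to sup_Q |g|.  Cut Q into M^d equal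
   cubes: |g| is at least th * sup_Q |g| somewhere in each of them, and everywhere
   in one of them.  Iterating, {|g| < th^N sup_Q |g|} has measure at most
   (1 - M^-d)^N |Q|.

   The covolume of g_t L_f(x) D, for a sublattice D of Z^k, is a maximum of minors
   which are affine combinations of f(x) whose coefficients include one of
   absolute value at least 1, so its supremum over the base cube is bounded below
   independently of D and t.  A stopping-time argument, by induction on the length
   of flags of sublattices, shows that outside a set of exponentially small measure
   x is marked: some flag has all covolumes in [eps, rho], and every other
   sublattice compatible with it has covolume at least rho.  At a marked x a short
   vector v cannot exist: adding v to the largest member of the flag not
   containing it would produce a compatible sublattice of covolume below eps. *)

(** * Lebesgue outer measure and cubes *)

Section OuterMeasure.
Variables (R : realType) (d : nat).
Implicit Types (A E : set 'rV[R]_d) (c : R).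

Definition cube (p : 'rV[R]_d) (r : R) : set 'rV[R]_d :=
  [set x | forall i, p 0 i <= x 0 i <= p 0 i + r].

Lemma box_vol_ge0 (a b : 'rV[R]_d) :
  (forall i, a 0 i <= b 0 i) -> 0 <= box_vol a b.
Proof. by move=> ab; apply: prodr_ge0 => i _; rewrite subr_ge0. Qed.

Lemma lebesgue_d_ge0 A : (0 <= lebesgue_d A)%E.
Proof.
apply: le_ereal_inf_tmp => _ [a [b [ab _ ->]]].
by apply: nneseries_ge0 => k _ _; rewrite lee_fin box_vol_ge0.
Qed.

Lemma le_lebesgue_d A E : A `<=` E -> (lebesgue_d A <= lebesgue_d E)%E.
Proof.
move=> AE; apply: ereal_inf_le_tmp => _ [a [b [ab Eab ->]]].
by exists a, b; split => //; exact: subset_trans Eab.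
Qed.

Lemma lebesgue_d_cube (p : 'rV[R]_d) (r : R) : (0 < d)%N -> 0 <= r ->
  (lebesgue_d (cube p r) <= (r ^+ d)%:E)%E.
Proof.
move=> d0 r0; apply: ereal_inf_lbound.
(* Box 0 is the cube itself; the others are reduced to the point [p], of volume 0 since [d > 0]. *)
exists (fun=> p), (fun k => if k == 0%N then p + const_mx r else p); split.
- by move=> k i; case: ifP => // _; rewrite !mxE lerDl.
- by move=> x px; exists 0%N => // i /=; rewrite !mxE; exact: px.
rewrite (@nneseriesD1 _ _ 0%N xpredT)//=; last first.
  by move=> k _; rewrite lee_fin box_vol_ge0// => i; case: ifP => // _;
    rewrite !mxE lerDl.
rewrite eseries0 ?adde0; last first.
  move=> k _ /= /negPf ->; congr EFin; rewrite /box_vol.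
  by rewrite (bigD1 (Ordinal d0))//= subrr mul0r.
congr EFin; rewrite /box_vol (eq_bigr (fun=> r)) ?prodr_const ?card_ord//.
by move=> i _; rewrite !mxE addrAC subrr add0r.
Qed.

(** Countable subadditivity: covers of the [A n] that are optimal up to [e / 2 ^ n.+1] merge into
    one along a bijection between [nat] and [nat * nat]. *)
Lemma lebesgue_d_bigcup (A : nat -> set 'rV[R]_d) (c : nat -> R) (C : R) :
  (forall n, (lebesgue_d (A n) <= (c n)%:E)%E) ->
  (forall m, \sum_(0 <= n < m) c n <= C) ->
  (lebesgue_d (\bigcup_n A n) <= C%:E)%E.
Proof.
move=> Ac cC; apply/lee_addgt0Pr => e e0.
have c0 n : 0 <= c n by rewrite -lee_fin (le_trans (lebesgue_d_ge0 (A n))).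
pose P n (ab : nat -> 'rV[R]_d * 'rV[R]_d) :=
  [/\ forall k i, (ab k).1 0 i <= (ab k).2 0 i,
    A n `<=` \bigcup_k box (ab k).1 (ab k).2 &
    (\sum_(0 <= k <oo) (box_vol (ab k).1 (ab k).2)%:E <=
      (c n + e / (2 ^ n.+1)%:R)%:E)%E].
have [G PG] : {G & forall n, P n (G n)}.
  apply: (@choice _ _ P) => n.
  have : (lebesgue_d (A n) < (c n + e / (2 ^ n.+1)%:R)%:E)%E.
    by rewrite (le_lt_trans (Ac n))// lte_fin ltrDl divr_gt0.
  move=> /ereal_inf_lt[_ [a [b [ab Aab ->]]] lt].
  by exists (fun k => (a k, b k)); split => //; exact: ltW.
have G0 n k : (0 <= (box_vol (G n k).1 (G n k).2)%:E)%E.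
  by rewrite lee_fin box_vol_ge0//; case: (PG n).
have /card_esym/card_set_bijP[f fbij] := card_nat2.
pose g (ij : nat * nat) := (box_vol (G ij.1 ij.2).1 (G ij.1 ij.2).2)%:E.
apply: (@le_trans _ _ (\sum_(0 <= k <oo) g (f k))%E).
  apply: ereal_inf_lbound.
  exists (fun k => (G (f k).1 (f k).2).1), (fun k => (G (f k).1 (f k).2).2).
  split => //; first by move=> k i; case: (PG (f k).1).
  move=> x [n _ Ax]; have [_ /(_ _ Ax)[k _ xk] _] := PG n.
  have [_ _ /(_ (n, k) I)[m _ fm]] := fbij.
  by exists m => //; rewrite fm.
rewrite nneseries_esumT; last by move=> k; exact: G0.
rewrite -(reindex_esum _ _ _ g fbij).
have -> : \esum_(j in [set: nat * nat]) g j =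
    \esum_(i in [set: nat]) \esum_(j in [set: nat]) g (i, j).
  rewrite esum_esum//; last by move=> i j _ _; exact: G0.
  have -> : [set: nat] `*`` (fun=> [set: nat]) = setT by rewrite predeqE.
  by apply: eq_esum => -[].
rewrite -nneseries_esumT; last by move=> k; apply: esum_ge0 => j _; exact: G0.
apply: (@le_trans _ _ (\sum_(0 <= k <oo) ((c k)%:E + (e / (2 ^ k.+1)%:R)%:E))%E).
  apply: lee_nneseries => [k _ _|k _]; first by apply: esum_ge0 => j _; exact: G0.
  rewrite -nneseries_esumT; first by case: (PG k).
  by move=> j; exact: G0.
apply: le_trans (epsilon_trick _ _ (ltW e0)) _.
  by move=> k; rewrite lee_fin.
rewrite leeD2r//; apply: lime_le.
  by apply: is_cvg_nneseries => k _ _; rewrite lee_fin.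
by apply: nearW => m; rewrite sumEFin lee_fin.
Qed.

Lemma lebesgue_d0 : (0 < d)%N -> (lebesgue_d (@set0 'rV[R]_d) <= 0)%E.
Proof.
move=> d0; apply: le_trans (le_lebesgue_d (@sub0set _ (cube 0 0))) _.
by rewrite (le_trans (lebesgue_d_cube _ _ _))// expr0n eqn0Ngt d0.
Qed.

Lemma lebesgue_dU A E (a e : R) : (0 < d)%N ->
  (lebesgue_d A <= a%:E)%E -> (lebesgue_d E <= e%:E)%E ->
  (lebesgue_d (A `|` E) <= (a + e)%:E)%E.
Proof.
move=> d0 Aa Ee.
have a0 : 0 <= a by rewrite -lee_fin (le_trans (lebesgue_d_ge0 A)).
have e0 : 0 <= e by rewrite -lee_fin (le_trans (lebesgue_d_ge0 E)).
apply: le_trans (le_lebesgue_d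
  (E := \bigcup_k nth set0 [:: A; E] k) _) _.
  by move=> x [?|?]; [exists 0%N|exists 1%N].
apply: (@lebesgue_d_bigcup _ (nth 0 [:: a; e])) => [[|[|n]]|[|[|m]]] //=.
- by rewrite !nth_nil; exact: lebesgue_d0.
- by rewrite big_geq// addr_ge0.
- by rewrite big_nat1 lerDl.
rewrite big_nat_recl// big_nat_recl//= big1 ?addr0// => k _.
by rewrite nth_nil.
Qed.

Lemma lebesgue_d_seq (I : eqType) (s : seq I) (A : I -> set 'rV[R]_d)
    (E : set 'rV[R]_d) (c : I -> R) : (0 < d)%N ->
  (forall x, E x -> exists2 i, i \in s & A i x) ->
  (forall i, i \in s -> (lebesgue_d (A i) <= (c i)%:E)%E) ->
  (lebesgue_d E <= (\sum_(i <- s) c i)%:E)%E.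
Proof.
move=> d0; elim: s E => [|i s IH] E Es Ac.
  rewrite big_nil; apply: le_trans (le_lebesgue_d _) (lebesgue_d0 d0).
  by move=> x /Es[].
rewrite big_cons.
apply: le_trans (le_lebesgue_d (E := A i `|` (E `\` A i)) _) _.
  by move=> x Ex; have [|] := pselect (A i x); [left|right].
apply: lebesgue_dU => //; first by apply: Ac; rewrite inE eqxx.
apply: IH => [x [/Es[j]]|j js]; last by apply: Ac; rewrite inE js orbT.
by rewrite inE => /orP[/eqP ->|js Aj _]; [|exists j].
Qed.

End OuterMeasure.

(** * Grids and stopping times *)

Section Grid.
Variables (R : realType) (d M : nat).
Hypothesis M1 : (1 < M)%N.
Let M0 : (0 < M)%N := ltnW M1.
Implicit Types (Q : 'rV[R]_d * R) (b : {ffun 'I_d -> 'I_M}) (X : set 'rV[R]_d).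

Definition pcube Q := cube Q.1 Q.2.
Definition child Q b : 'rV[R]_d * R :=
  (\row_i (Q.1 0 i + Q.2 / M%:R * (b i)%:R), Q.2 / M%:R).
Definition subcube X Q := 0 < Q.2 /\ pcube Q `<=` X.

Lemma child_sub Q b : 0 < Q.2 -> pcube (child Q b) `<=` pcube Q.
Proof.
move=> r0 x xb i; have /= := xb i; rewrite !mxE => /andP[h1 h2].
have h0 : 0 < Q.2 / M%:R by rewrite divr_gt0// ltr0n.
apply/andP; split.
  by apply: le_trans h1; rewrite lerDl mulr_ge0// ltW.
apply: le_trans h2 _; rewrite -addrA lerD2l.
  have -> : Q.2 / M%:R * (b i)%:R + Q.2 / M%:R = Q.2 / M%:R * (b i).+1%:R.
    by rewrite -natr1 mulrDr mulr1.
apply: (@le_trans _ _ (Q.2 / M%:R * M%:R)); last by rewrite divfK// pnatr_eq0 -lt0n.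
by rewrite ler_pM2l// ler_nat ltn_ord.
Qed.

Lemma subcube_child X Q b : subcube X Q -> subcube X (child Q b).
Proof.
move=> [r0 QX]; split; first by rewrite /= divr_gt0// ltr0n.
exact: subset_trans (@child_sub Q b r0) QX.
Qed.

Lemma grid_cell (h t : R) (m : nat) : (0 < m)%N -> 0 <= t <= h * m%:R ->
  exists k : 'I_m, h * k%:R <= t <= h * k%:R + h.
Proof.
elim: m => // -[_ _|m IH _]; first by rewrite mulr1 => t01; exists ord0; rewrite mulr0 add0r.
move=> /andP[t0 tm]; have [tle|tgt] := lerP t (h * m.+1%:R).
  have [|k kt] := IH isT; first by rewrite t0.
  by exists (widen_ord (leqnSn _) k).
by exists ord_max; rewrite ltW//= -[X in _ + X]mulr1 -mulrDr natr1.
Qed.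

Lemma child_cover Q x : pcube Q x -> exists b, pcube (child Q b) x.
Proof.
move=> Qx; have /choice[b bP] : forall i : 'I_d, exists k : 'I_M,
    Q.2 / M%:R * k%:R <= x 0 i - Q.1 0 i <= Q.2 / M%:R * k%:R + Q.2 / M%:R.
  move=> i; apply: grid_cell => //; rewrite divfK ?pnatr_eq0 -?lt0n//.
  by have := Qx i; rewrite subr_ge0 lerBlDl.
exists [ffun i => b i] => i /=; have := bP i; rewrite !mxE ffunE => /andP[h1 h2].
by rewrite -lerBrDl h1 -addrA -lerBlDl h2.
Qed.

Lemma sum_child_vol Q : \sum_b (child Q b).2 ^+ d = Q.2 ^+ d.
Proof.
rewrite /= sumr_const card_ffun !card_ord -[LHS]mulr_natr natrX -exprMn divfK//.
by rewrite pnatr_eq0 -lt0n.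
Qed.

Hypothesis d0 : (0 < d)%N.

Section Stopping.
Variables (X E : set 'rV[R]_d) (stop : 'rV[R]_d * R -> Prop) (kap : R).
Hypotheses (kap0 : 0 <= kap)
  (stop_small : forall x, E x -> exists2 dl, 0 < dl &
    forall Q, subcube X Q -> pcube Q x -> Q.2 <= dl -> stop Q)
  (stop_child : forall Q b, subcube X Q -> ~ stop Q -> stop (child Q b) ->
    (lebesgue_d (E `&` pcube (child Q b)) <= (kap * (child Q b).2 ^+ d)%:E)%E).

Let children (Qs : seq ('rV[R]_d * R)) := [seq child Q b | Q <- Qs, b <- enum {ffun 'I_d -> 'I_M}].
(** [active] keeps the descendants reached without meeting [stop]; [stopped] collects the first cube
    to stop on each branch. *)
Fixpoint active Q n := if n is n'.+1 then
  [seq Q' <- children (active Q n') | ~~ `[< stop Q' >]] else [:: Q].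
Let stopped Q n := [seq Q' <- children (active Q n) | `[< stop Q' >]].

Let sum_children (Qs : seq ('rV[R]_d * R)) :
  \sum_(Q <- children Qs) Q.2 ^+ d = \sum_(Q <- Qs) Q.2 ^+ d.
Proof.
rewrite /children big_allpairs_dep; apply: eq_bigr => Q _; rewrite big_enum.
exact: sum_child_vol.
Qed.

Let active_stopped_vol Q n :
  \sum_(0 <= m < n) \sum_(Q' <- stopped Q m) Q'.2 ^+ d
    + \sum_(Q' <- active Q n) Q'.2 ^+ d = Q.2 ^+ d.
Proof.
elim: n => [|n IH]; first by rewrite big_geq// add0r big_seq1.
rewrite big_nat_recr//= -addrA -{}IH; congr (_ + _).
rewrite !big_filter -sum_children.
by rewrite [RHS](bigID (fun Q' => `[< stop Q' >])).
Qed.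

Let activeP Q n : subcube X Q -> ~ stop Q ->
  forall Q', Q' \in active Q n ->
  [/\ subcube X Q', ~ stop Q' & Q'.2 = Q.2 / M%:R ^+ n].
Proof.
move=> XQ sQ; elim: n => [|n IH] Q' /=.
  by rewrite inE => /eqP ->; rewrite expr0 divr1.
rewrite mem_filter => /andP[/asboolPn sQ'] /allpairsP[[Q1 b] /= [/IH[h1 h2 h3] _ e]].
rewrite e; split; rewrite -?e//; first by rewrite e; exact: subcube_child.
by rewrite e /= h3 exprS invfM mulrA mulrAC.
Qed.

(** The first stopped cubes cover the part of [E] inside [Q], and their total volume is at most that
    of [Q] because subdividing preserves volume; [stop_child] applies to each, its parent being
    active. *)
Lemma stopping_cover Q : subcube X Q -> ~ stop Q ->
  (lebesgue_d (E `&` pcube Q) <= (kap * Q.2 ^+ d)%:E)%E.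
Proof.
move=> XQ sQ.
pose F n := [set x | E x /\ exists2 Q', Q' \in stopped Q n & pcube Q' x].
have cov : E `&` pcube Q `<=` \bigcup_n F n.
  (* A point of [E] in no stopped cube would lie in an active cube of every generation, whereas
     [stop_small] forces the small ones to stop. *)
  move=> x [Ex Qx]; apply: contrapT => nF.
  have act n : exists2 Q', Q' \in active Q n & pcube Q' x.
    elim: n => [|n [Q' aQ' Q'x]]; first by exists Q; rewrite ?inE.
    have [b bx] := child_cover Q'x.
    have ch : child Q' b \in children (active Q n).
      by apply/allpairsP; exists (Q', b); rewrite mem_enum.
    have [st|nst] := pselect (stop (child Q' b)).
      exfalso; apply: nF; exists n => //; split=> //; exists (child Q' b) => //.
      by rewrite mem_filter ch andbT; apply/asboolP.
    by exists (child Q' b) => //=; rewrite mem_filter ch andbT; apply/asboolPn.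
  have [dl dl0 sdl] := stop_small Ex.
  have [n Mn] : exists n, Q.2 / M%:R ^+ n <= dl.
    exists (Num.truncn (Q.2 / dl)).+1.
    rewrite ler_pdivrMr ?exprn_gt0 ?ltr0n// mulrC -ler_pdivrMr//.
    apply: le_trans (ltW (truncnS_gt _)) _.
    by rewrite -natrX ler_nat; apply: ltnW; apply: ltn_expl.
  have [Q' aQ' Q'x] := act n; have [XQ' nQ' e] := activeP XQ sQ aQ'.
  by apply: nQ'; apply: sdl => //; rewrite e.
apply: le_trans (le_lebesgue_d cov) _.
apply: (@lebesgue_d_bigcup _ _ _ (fun n => kap * \sum_(Q' <- stopped Q n) Q'.2 ^+ d)).
  move=> n; rewrite mulr_sumr.
  apply: (@lebesgue_d_seq _ _ _ _ (fun Q' => E `&` pcube Q')) => //.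
    by move=> x [Ex [Q' sQ' Q'x]]; exists Q'.
  move=> Q'; rewrite mem_filter => /andP[/asboolP sQ'].
  move=> /allpairsP[[Q1 b] /= [/(activeP XQ sQ)[h1 h2 h3] _ e]].
  by rewrite e; apply: stop_child => //; rewrite -e.
move=> m; rewrite -mulr_sumr ler_wpM2l// -(active_stopped_vol Q m) lerDl.
rewrite big_seq; apply: sumr_ge0 => Q' /(activeP XQ sQ)[[h _] _ _].
by rewrite exprn_ge0// ltW.
Qed.

End Stopping.
End Grid.

(** * Porous functions and marked points *)

Section Porosity.
Variables (R : realType) (d M : nat).
Hypotheses (M1 : (1 < M)%N) (d0 : (0 < d)%N).

(** The proportion of volume left after discarding one of [M ^ d] equal children. *)
Definition tau : R := 1 - (M ^ d)%:R^-1.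

Lemma tau_ge0 : 0 <= tau.
Proof.
by rewrite subr_ge0 invf_le1 ?ltr0n ?ler1n ?expn_gt0 ltnW.
Qed.

Lemma tau_lt1 : tau < 1.
Proof. by rewrite ltrBlDr ltrDl invr_gt0 ltr0n expn_gt0 ltnW. Qed.

(** The first clause lets an estimate restart in every child; the second lets one whole child be
    discarded. *)
Definition porous (X : set 'rV[R]_d) (th : R) (g : 'rV[R]_d -> R) :=
  forall Q x, subcube X Q -> pcube Q x ->
  (forall b : {ffun 'I_d -> 'I_M}, exists2 y, pcube (child Q b) y &
      th * `|g x| <= `|g y|) /\
  (exists b : {ffun 'I_d -> 'I_M}, forall y, pcube (child Q b) y ->
      th * `|g x| <= `|g y|).

(** Induction on [N]. The child given by the second clause misses the sublevel set altogether; every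
    other child contains a point where [|g|] has lost only a factor [th], and the induction
    hypothesis applies from there. *)
Lemma porous_sublevel X th g : 0 <= th <= 1 -> porous X th g ->
  forall N Q x eps, subcube X Q -> pcube Q x -> eps <= th ^+ N * `|g x| ->
  (lebesgue_d (pcube Q `&` [set y | (`|g y| < eps)%R]) <=
    (tau ^+ N * Q.2 ^+ d)%:E)%E.
Proof.
move=> /andP[th0 th1] gX; elim=> [|N IH] Q x eps XQ Qx le_eps.
  rewrite expr0 mul1r; apply: le_trans (lebesgue_d_cube Q.1 d0 (ltW XQ.1)).
  by apply: le_lebesgue_d => y [].
have [wit [b0 b0P]] := gX _ _ XQ Qx.
have -> : tau ^+ N.+1 * Q.2 ^+ d =
    \sum_(b <- enum (predC1 b0)) tau ^+ N * (child Q b).2 ^+ d.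
  rewrite big_enum/= sumr_const -[RHS]mulr_natr exprSr -!mulrA; congr (_ * _).
  have -> : #|predC1 b0| = (M ^ d).-1.
    by rewrite cardC1 card_ffun !card_ord.
  have Md0 : (0 < M ^ d)%N by rewrite expn_gt0 (ltnW M1).
  rewrite -subn1 (natrB _ Md0) exprMn exprVn natrX.
  have : (M%:R : R) ^+ d != 0 by rewrite expf_neq0// pnatr_eq0 -lt0n ltnW.
  by rewrite /tau natrX; move: (M%:R ^+ d) => u u0; field.
apply: (@lebesgue_d_seq _ _ _ _
  (fun b => pcube (child Q b) `&` [set y | (`|g y| < eps)%R]) _
  (fun b => tau ^+ N * (child Q b).2 ^+ d)) => //.
  move=> y [Qy gy]; have [b by_] := child_cover M1 Qy.
  exists b => //; rewrite mem_enum inE/=; apply: contraTneq gy => bb0 /=.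
  rewrite -leNgt (le_trans le_eps)//; apply: le_trans (b0P y _); last by rewrite -bb0.
  by rewrite exprS -mulrA mulrCA ler_piMl ?mulr_ge0// exprn_ile1.
move=> b _; have [y by_ gy] := wit b.
apply: (IH _ y); [exact: subcube_child|exact: by_|].
by rewrite (le_trans le_eps)// exprSr -mulrA ler_wpM2l// exprn_ge0.
Qed.

End Porosity.

Section Nondivergence.
Variables (R : realType) (d M : nat).
Hypotheses (M1 : (1 < M)%N) (d0 : (0 < d)%N).
Variables (S : Type) (dim : S -> nat) (comp : S -> S -> Prop).
Variables (psi : S -> 'rV[R]_d -> R) (rho eps : R).

(* A point is marked when the elements of some chain have [eps <= psi <= rho]
   at it, while every element comparable to the whole chain and outside it has
   [psi >= rho]; [P] is the set of elements comparable to the part of the chain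
   already chosen. *)
Inductive marked (x : 'rV[R]_d) : (S -> Prop) -> Prop :=
| marked_end (P : S -> Prop) : (forall s, P s -> rho <= psi s x) -> marked x P
| marked_cons (P : S -> Prop) s : P s -> eps <= psi s x -> psi s x <= rho ->
    marked x (fun s' => [/\ P s', comp s s' & dim s' <> dim s]) -> marked x P.

(** One unit pays for the sublevel set of the new chain member, and [M ^ d] for passing from the
    volume of a parent cube to that of its child. *)
Fixpoint flag_const (m : nat) : nat :=
  if m is m'.+1 then M ^ d * (flag_const m').+1 else 0%N.

Variables (X : set 'rV[R]_d) (kap : R).
Hypothesis kap0 : 0 <= kap.

(** Subdivide until some [psi s] is below [rho] on a whole cube. Where [psi s] is at least [eps]
    there, [s] can join the chain, and [D] loses the value [dim s]: the induction is on the number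
    of dimensions still available. *)
Lemma measure_unmarked (m : nat) (P : S -> Prop) (D : seq nat) (Q : 'rV[R]_d * R) :
  (forall s (Q : 'rV[R]_d * R) x, P s -> subcube X Q -> pcube Q x -> rho <= psi s x ->
    (lebesgue_d (pcube Q `&` [set y | (psi s y < eps)%R]) <= (kap * Q.2 ^+ d)%:E)%E) ->
  (forall s x, P s -> X x -> psi s x < rho -> exists2 dl, 0 < dl &
    forall y : 'rV[R]_d, (forall i, `|y 0 i - x 0 i| <= dl) -> psi s y < rho) ->
  (size D <= m)%N -> (forall s, P s -> dim s \in D) ->
  subcube X Q ->
  (forall s, P s -> exists2 x, pcube Q x & rho <= psi s x) ->
  (lebesgue_d (pcube Q `&` [set x | ~ marked x P]) <=
    ((flag_const m)%:R * kap * Q.2 ^+ d)%:E)%E.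
Proof.
elim: m P D Q => [|m IH] P D Q good cont Dm PD XQ PQ.
  rewrite mul0r mul0r; apply: le_trans (lebesgue_d0 _ d0); apply: le_lebesgue_d.
  move=> x [_]; apply; apply: marked_end => s /PD.
  by move: Dm; rewrite leqn0 => /nilP ->.
pose stop Q' := exists2 s, P s & forall x, pcube Q' x -> psi s x < rho.
have nstop Q' : ~ stop Q' -> forall s, P s -> exists2 x, pcube Q' x & rho <= psi s x.
  move=> nst s Ps; apply: contrapT => nex; apply: nst; exists s => // x Q'x.
  by rewrite ltNge; apply/negP => le; apply: nex; exists x.
rewrite setIC; apply: (stopping_cover M1 d0 (X := X) (stop := stop)) => //.
- by rewrite mulr_ge0.
(* At an unmarked [x] some [psi s] is below [rho], otherwise the empty chain would mark it; by
   [cont] all small cubes around [x] then stop. *)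
- move=> x; apply: contra_notP => nex; apply: marked_end => s Ps.
  rewrite leNgt; apply/negP => lt; apply: nex.
  have [Xx|nXx] := pselect (X x); last by exists 1 => // Q1 [_ Q1X] /Q1X.
  have [dl dl0 near_x] := cont s x Ps Xx lt; exists dl => // Q1 _ Q1x Q1dl.
  exists s => // y Q1y; apply: near_x => i; apply: le_trans Q1dl.
  by have := Q1x i; have := Q1y i; rewrite ler_norml => ? ?; lra.
- move=> Q' b XQ' nQ' [s Ps sb].
  (* Both estimates are made on the parent [Q']: it has not stopped, so every element of [P] reaches
     [rho] on it, as [good] and the induction hypothesis require. *)
  pose P' s' := [/\ P s', comp s s' & dim s' <> dim s].
  have vol : (flag_const m.+1)%:R * kap * (child Q' b).2 ^+ d =
     kap * Q'.2 ^+ d + (flag_const m)%:R * kap * Q'.2 ^+ d.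
    rewrite /= natrM -natr1 natrX exprMn exprVn.
    have : (M%:R : R) ^+ d != 0 by rewrite expf_neq0// pnatr_eq0 -lt0n ltnW.
    by move: (M%:R ^+ d) => u u0; field.
  rewrite vol.
  apply: le_trans (le_lebesgue_d (E := (pcube Q' `&` [set y | psi s y < eps]) `|`
    (pcube Q' `&` [set x | ~ marked x P'])) _) _.
    move=> x [nm xb]; have Q'x := child_sub M1 XQ'.1 xb.
    have [lt|le] := ltP (psi s x) eps; [by left|right; split=> // mP'].
    by apply: nm; apply: marked_cons Ps le _ mP'; exact: ltW (sb _ _).
  apply: lebesgue_dU => //.
    by have [x Q'x le] := nstop _ nQ' s Ps; exact: (good s Q' x).
  apply: (IH P' [seq k <- D | k != dim s]) => //.
  + by move=> s' Q1 x [Ps' _ _]; exact: good.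
  + by move=> s' x [Ps' _ _]; exact: cont.
  + rewrite -ltnS; apply: leq_trans Dm; rewrite size_filter.
    rewrite -(count_predC (pred1 (dim s)) D) addnC -addn1 leq_add2l -has_count.
    by rewrite has_pred1 PD.
  + by move=> s' [Ps' _ /eqP ne]; rewrite mem_filter ne PD.
  + by move=> s' [Ps' _ _]; exact: nstop.
- move=> [s Ps lt]; have [x Qx le] := PQ s Ps.
  by have := lt x Qx; rewrite ltNge le.
Qed.

End Nondivergence.

(** * Minors and reduced lattice bases *)

Section Minors.
Variables (R : realType) (k : nat).

(** The sup norm of the exterior product of the rows: a non-injective [f] gives a zero minor and a
    reordering only a sign. *)
Definition maxminor (j : nat) (A : 'M[R]_(j, k)) : R :=
  \big[Num.max/0]_(f : {ffun 'I_j -> 'I_k}) `|\det (colsub f A)|.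

Lemma le_maxminor j (A : 'M[R]_(j, k)) (f : 'I_j -> 'I_k) :
  `|\det (colsub f A)| <= maxminor A.
Proof.
have -> : colsub f A = colsub (finfun f) A.
  by apply/matrixP => a b; rewrite !mxE ffunE.
exact: (le_bigmax _ (fun f : {ffun _} => `|\det (colsub f A)|)).
Qed.

Lemma maxminor_le j (A : 'M[R]_(j, k)) (c : R) : 0 <= c ->
  (forall f : {ffun 'I_j -> 'I_k}, `|\det (colsub f A)| <= c) ->
  maxminor A <= c.
Proof. by move=> c0 Ac; apply: bigmax_le. Qed.

Lemma maxminor_ge0 j (A : 'M[R]_(j, k)) : 0 <= maxminor A.
Proof. exact: bigmax_ge_id. Qed.

Lemma maxminor_geP j (A : 'M[R]_(j, k)) (c : R) : 0 < c -> c <= maxminor A ->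
  exists f : {ffun 'I_j -> 'I_k}, c <= `|\det (colsub f A)|.
Proof.
move=> c0; apply: contraPP => nex; apply/negP; rewrite -ltNge.
apply: bigmax_lt => // f _; rewrite ltNge; apply/negP => cf.
by apply: nex; exists f.
Qed.

Lemma colsub_mulmx j (X : 'M[R]_j) (A : 'M[R]_(j, k)) (f : 'I_j -> 'I_k) :
  colsub f (X *m A) = X *m colsub f A.
Proof. by apply/matrixP => a b; rewrite !mxE; apply: eq_bigr => c _; rewrite !mxE. Qed.

Lemma maxminor_mulmx_le j (X : 'M[R]_j) (A : 'M[R]_(j, k)) :
  maxminor (X *m A) <= `|\det X| * maxminor A.
Proof.
apply: maxminor_le => [|f]; first by rewrite mulr_ge0// maxminor_ge0.
by rewrite colsub_mulmx det_mulmx normrM ler_wpM2l// le_maxminor.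
Qed.

Lemma maxminor_le_mulmx j (X : 'M[R]_j) (A : 'M[R]_(j, k)) : 1 <= `|\det X| ->
  maxminor A <= maxminor (X *m A).
Proof.
move=> X1; apply: maxminor_le => [|f]; first exact: maxminor_ge0.
apply: le_trans (le_maxminor _ f); rewrite colsub_mulmx det_mulmx normrM.
by rewrite ler_peMl.
Qed.

Lemma row_free_minor j (A : 'M[R]_(j, k)) : row_free A ->
  exists f : 'I_j -> 'I_k, \det (colsub f A) != 0.
Proof.
rewrite /row_free -mxrank_tr => fullA; exists (fullrankfun fullA).
have := fullrowsub_unit fullA; rewrite unitmxE unitfE -det_tr.
by congr (\det _ != 0); apply/matrixP => a b; rewrite !mxE.
Qed.

Lemma maxminor_gt0 j (A : 'M[R]_(j, k)) : row_free A -> 0 < maxminor A.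
Proof.
move=> /row_free_minor[f f0]; apply: lt_le_trans (le_maxminor _ f).
by rewrite normr_gt0.
Qed.

(** Laplace expansion along the row [v]: the [j.+1] cofactors are, up to sign, minors of [A]. *)
Lemma maxminor_col_mx j (v : 'rV[R]_k) (A : 'M[R]_(j, k)) (w : R) :
  0 <= w -> (forall i, `|v 0 i| <= w) ->
  maxminor (col_mx v A) <= j.+1%:R * w * maxminor A.
Proof.
move=> w0 vw; apply: maxminor_le => [|f]; first by rewrite !mulr_ge0// maxminor_ge0.
rewrite (expand_det_row _ ord0) (le_trans (ler_norm_sum _ _ _))//.
rewrite -mulrA mulr_natl -[X in _ *+ X]card_ord -sumr_const ler_sum// => c _.
rewrite normrM; apply: ler_pM => //.
  by rewrite !mxE; case: splitP => // a _; rewrite ord1.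
rewrite /cofactor normrM normrX normrN1 expr1n mul1r.
apply: le_trans (le_maxminor _ (f \o lift c)); rewrite le_eqVlt; apply/orP; left.
apply/eqP; congr (`|\det _|); apply/matrixP => a b; rewrite !mxE.
case: splitP => [[[]]//|a' /= aa']; congr (A _ _); apply: val_inj => /=.
by move: aa'; rewrite /bump leq0n !add1n => -[].
Qed.

End Minors.

Section ReducedBases.
Variables (R : realType) (k : nat).
Local Notation toR := (map_mx (intr : int -> R)).

Lemma maxminor_nat j (A : 'M[int]_(j, k)) : maxminor (toR A) \is a Num.nat.
Proof.
apply: (big_ind (fun x => x \is a Num.nat)) => [|x y xn yn|f _].
- exact: rpred0.
- by rewrite maxEle; case: ifP.
- by rewrite -map_mxsub det_map_mx natr_norm_int// intr_int.
Qed.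

(* The covolume of the lattice spanned by the rows of [A] cannot be lowered
   within its linear span, whatever the linear map [G]. *)
Definition reduced j (A : 'M[int]_(j, k)) := row_free (toR A) /\
  forall A' : 'M[int]_(j, k), row_free (toR A') -> (toR A' <= toR A)%MS ->
  forall G : 'M[R]_k, maxminor (toR A *m G) <= maxminor (toR A' *m G).

Lemma row_free_sub_eqmx j (A B : 'M[R]_(j, k)) : row_free A -> row_free B ->
  (A <= B)%MS -> (A == B)%MS.
Proof.
move=> /eqP rA /eqP rB AB.
by rewrite -(mxrank_leqif_eq AB) rA rB.
Qed.

(** Among the integer bases of the same real span, take one of least [maxminor], a natural number.
    Any competitor is [X *m A] with [|\det X| >= 1] by minimality, and this factor is the same for
    every [G]. *)
Lemma reduced_hull j (A0 : 'M[int]_(j, k)) : row_free (toR A0) ->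
  exists2 A : 'M[int]_(j, k), reduced A & (toR A == toR A0)%MS.
Proof.
move=> A0free.
pose P m := `[< exists A : 'M[int]_(j, k),
  [/\ row_free (toR A), (toR A == toR A0)%MS & maxminor (toR A) = m%:R] >].
have nat_mm (A : 'M[int]_(j, k)) : exists m, maxminor (toR A) = m%:R :> R.
  by have /natrP := maxminor_nat A.
have exP : exists m, P m.
  have [m e] := nat_mm A0; exists m; apply/asboolP; exists A0; split => //.
  by rewrite !submx_refl.
case: (ex_minnP exP) => m /asboolP[A [Afree AA0 Am]] mmin.
exists A => //; split=> // A' A'free /[dup] A'A /submxP[X XA] G.
rewrite XA -mulmxA; apply: maxminor_le_mulmx.
have A_gt0 := maxminor_gt0 Afree.
rewrite -(ler_pM2r A_gt0) mul1r; apply: le_trans (maxminor_mulmx_le _ _).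
have [m' em'] := nat_mm A'; rewrite -XA em' Am ler_nat; apply: mmin.
apply/asboolP; exists A'; split=> //.
have /andP[h1 h2] := row_free_sub_eqmx A'free Afree A'A.
by move: AA0 => /andP[h3 h4]; rewrite (submx_trans h1 h3) (submx_trans h4 h2).
Qed.

End ReducedBases.

(** * Short vectors at marked points *)

Section ShortVectors.
Variables (R : realType) (d k : nat) (G : 'rV[R]_d -> 'M[R]_k) (rho eps : R).
Local Notation toR := (map_mx (intr : int -> R)).
Local Notation latt := {j : nat & 'M[int]_(j, k)}.
Implicit Types (s U W : latt).

Definition span s : 'M[R]_(tag s, k) := toR (tagged s).
Definition comparable_span s s' := (span s <= span s')%MS || (span s' <= span s)%MS.
Definition covol s (x : 'rV[R]_d) : R := maxminor (span s *m G x).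
Definition reduced_latt s := reduced R (tagged s).
Local Notation marked := (marked (@tag nat _) comparable_span covol rho eps).

Hypotheses (eps_rho : eps <= rho) (rho1 : rho <= 1).

Lemma reduced_rank s : reduced_latt s -> \rank (span s) = tag s.
Proof. by move=> [/eqP]. Qed.

Lemma comparable_le s s' : reduced_latt s -> row_free (span s') ->
  comparable_span s s' -> (tag s <= tag s')%N -> (span s <= span s')%MS.
Proof.
move=> rs /eqP rs' /orP[//|s's] le.
have := mxrank_leqif_eq s's => -[_ /esym]; rewrite (reduced_rank rs) rs'.
have := mxrankS s's; rewrite (reduced_rank rs) rs' => le'.
by rewrite eqn_leq le le' => /andP[].
Qed.

Lemma reduced_covol s s' x : reduced_latt s -> row_free (span s') ->
  (span s' <= span s)%MS -> tag s' = tag s -> covol s x <= covol s' x.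
Proof.
case: s s' => j A [j' A'] [_ Amin] /= free' sub e; subst j'; exact: Amin.
Qed.

(** The vector [v] falls in the gap between [U] and [W]. Each chain member either shrinks the gap
    around [v] or lies outside it. Once the chain is used up, the lattice generated by [U] and [v]
    has covolume at least [eps], but also at most [k%:R * w] because [covol U x <= 1]. *)
Lemma marked_gap x (P : latt -> Prop) : marked x P -> forall U W,
  row_free (span U) -> row_free (span W) -> (span U <= span W)%MS ->
  covol U x <= 1 ->
  (forall s, row_free (span s) -> (span s <= span W)%MS -> tag s = tag W ->
     eps <= covol s x) ->
  (forall s, reduced_latt s -> (span U <= span s)%MS -> (span s <= span W)%MS ->
     (tag U < tag s < tag W)%N -> P s) ->
  (forall s, P s -> [/\ reduced_latt s, comparable_span s U & comparable_span s W]) ->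
  forall (v : 'rV[int]_k) (w : R), (toR v <= span W)%MS -> ~~ (toR v <= span U)%MS ->
  (forall i, `|(toR v *m G x) 0 i| <= w) -> 0 <= w ->
  eps <= k%:R * w.
Proof.
elim=> {P} [P mP|P s Ps eps_s s_rho _ IH] U W freeU freeW UW U1 Weps gapP PUW v w vW vU vw w0.
  pose A := col_mx v (tagged U).
  have toRA : toR A = col_mx (toR v) (span U) by rewrite map_col_mx.
  have Afree : row_free (toR A).
    rewrite /row_free eqn_leq rank_leq_row/= toRA -addsmxE.
    have : (span U < toR v + span U)%MS.
      by rewrite ltmxE addsmxSr/=; apply: contra vU; apply: submx_trans; exact: addsmxSl.
    by rewrite ltmxErank => /andP[_]; move/eqP: freeU => ->.
  have AW : (toR A <= span W)%MS by rewrite toRA -addsmxE addsmx_sub vW.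
  have [B [Bfree Bmin] /andP[BA AB]] := reduced_hull Afree.
  pose s : latt := Tagged (fun j => 'M[int]_(j, k)) B.
  have sW : (span s <= span W)%MS := submx_trans BA AW.
  have eps_s : eps <= covol s x.
    (* If [U] and [v] already span [W], the bound is [Weps]; otherwise [s] is strictly inside the
       gap, belongs to [P] and has covolume at least [rho]. *)
    have := mxrankS sW; rewrite (eqP Bfree) (eqP freeW) leq_eqVlt => /orP[/eqP e|lt].
      exact: Weps.
    apply: le_trans eps_rho (mP s _); apply: gapP => //.
      by apply: submx_trans AB; rewrite toRA -addsmxE addsmxSr.
    by rewrite /= lt andbT.
  apply: le_trans eps_s _; apply: le_trans (Bmin _ Afree AB (G x)) _.
  rewrite toRA mul_col_mx; apply: le_trans (maxminor_col_mx _ w0 vw) _.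
  apply: (@le_trans _ _ ((tag U).+1%:R * w)).
    by rewrite ler_piMr// mulr_ge0.
  by rewrite ler_wpM2r// ler_nat -add1n -(eqP Afree) rank_leq_col.
have [sred sU sW] := PUW s Ps.
have sfree : row_free (span s) := sred.1.
pose Q s' := [/\ P s', comparable_span s s' & tag s' <> tag s].
have Qred s' : Q s' -> [/\ reduced_latt s', comparable_span s' U & comparable_span s' W].
  by move=> [/PUW].
(* A chain member of rank at most that of [U] lies below [U] and leaves the gap unchanged; likewise
   one of rank at least that of [W] lies above [W]. *)
have [sleU|Ults] := leqP (tag s) (tag U).
  have sub := comparable_le sred freeU sU sleU.
  apply: (IH U W) vW vU vw w0 => // s' red' Us' s'W lt'; split; first exact: gapP.
    by rewrite /comparable_span (submx_trans sub Us').
  by move=> e; move: lt'; rewrite e ltnNge sleU.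
have [Wles|sltW] := leqP (tag W) (tag s).
  have Wred : (span W <= span s)%MS.
    case/orP: sW => // sW; have := mxrankS sW.
    rewrite (eqP sfree) (eqP freeW) => le.
    have := mxrank_leqif_eq sW => -[_ /esym]; rewrite (eqP sfree) (eqP freeW).
    by rewrite eqn_leq le Wles => /andP[].
  apply: (IH U W) vW vU vw w0 => // s' red' Us' s'W lt'; split; first exact: gapP.
    by rewrite /comparable_span (submx_trans s'W Wred) orbT.
  by move=> e; move: lt'; rewrite e (ltnNge (tag s) (tag W)) Wles andbF.
have Us : (span U <= span s)%MS.
  case/orP: sU => // sU; have := mxrankS sU.
  by rewrite (eqP sfree) (eqP freeU) leqNgt Ults.
have {sW} sW : (span s <= span W)%MS.
  case/orP: sW => // sW; have := mxrankS sW.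
  by rewrite (eqP sfree) (eqP freeW) leqNgt sltW.
have Qs s' : Q s' -> [/\ reduced_latt s', comparable_span s' U & comparable_span s' s] /\
    [/\ reduced_latt s', comparable_span s' s & comparable_span s' W].
  move=> [/PUW[? ? ?] cs _]; have cs' : comparable_span s' s by rewrite /comparable_span orbC.
  by [].
(* Strictly inside the gap, [s] becomes the upper end if it contains [v], by [eps <= covol s x], and
   the lower end otherwise, by [covol s x <= rho <= 1]. *)
have [vs|vs] := boolP (toR v <= span s)%MS.
  apply: (IH U s) vs vU vw w0 => //.
  - move=> s' s'free s's e; exact: le_trans (reduced_covol x sred s'free s's e).
  - move=> s' red' Us' s's /andP[l1 l2]; split.
    + apply: gapP => //; first exact: submx_trans s's sW.
      by rewrite l1 (ltn_trans l2).
    + by rewrite /comparable_span s's orbT.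
    + by move=> e; rewrite e ltnn in l2.
  - by move=> s' /Qs[].
apply: (IH s W) vW vs vw w0 => //; first exact: le_trans s_rho rho1.
- move=> s' red' ss' s'W /andP[l1 l2]; split.
  + apply: gapP => //; first exact: submx_trans Us ss'.
    by rewrite l2 (ltn_trans Ults).
  + by rewrite /comparable_span ss'.
  + by move=> e; rewrite e ltnn in l1.
- by move=> s' /Qs[].
Qed.

Lemma marked_no_short_vector x (P : latt -> Prop) (v : 'cV[int]_k) (w : R) :
  marked x P -> \det (G x) = 1 ->
  (forall s, P s <-> reduced_latt s /\ (0 < tag s)%N) ->
  v != 0 -> 0 <= w -> (forall i, `|(toR v^T *m G x) 0 i| <= w) ->
  eps <= k%:R * w.
Proof.
move=> mx detG Pred v0 w0 vw.
(* The initial gap goes from the zero lattice, whose only minor is the empty determinant 1, to Z^k,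
   where independent integer rows have a nonzero integer determinant and [G x] has determinant 1. *)
pose U : latt := Tagged (fun j => 'M[int]_(j, k)) (0 : 'M[int]_(0, k)).
pose W : latt := Tagged (fun j => 'M[int]_(j, k)) (1%:M : 'M[int]_k).
have WE : span W = 1%:M by rewrite /span /= map_mx1.
have freeU : row_free (span U) by rewrite /row_free -leqn0 rank_leq_row.
have freeW : row_free (span W) by rewrite WE row_free_unit unitmx1.
have U0 : span U = 0 by exact: flatmx0.
have subU s : (span U <= span s)%MS by rewrite U0 sub0mx.
have subW m (A : 'M[R]_(m, k)) : (A <= span W)%MS by rewrite WE submx1.
apply: (marked_gap mx (U := U) (W := W)) _ _ vw w0 => //.
- apply: maxminor_le => // f; by rewrite det_mx00 normr1.
- move=> [j B] /= Bfree _ e; subst j.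
  apply: le_trans eps_rho (le_trans rho1 _).
  apply: le_trans (le_maxminor _ (id : 'I_k -> 'I_k)).
  rewrite (_ : colsub id _ = span (Tagged (fun j => 'M[int]_(j, k)) B) *m G x); last first.
    by apply/matrixP => a b; rewrite !mxE.
  rewrite det_mulmx detG mulr1 /span /= det_map_mx.
  rewrite -intr_norm ler1z -gtz0_ge1 normr_gt0.
  move: Bfree; rewrite row_free_unit unitmxE unitfE /span /= det_map_mx.
  by rewrite intr_eq0.
- move=> s sred _ _ /andP[s0 _]; exact/Pred.
- move=> s /Pred[sred _]; split=> //; rewrite /comparable_span ?subU ?subW ?orbT//.
- apply: contra v0; rewrite U0 => /submx0null/matrixP v0.
  apply/eqP/matrixP => i j; have := v0 j i; rewrite !mxE => /eqP.
  by rewrite intr_eq0 => /eqP.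
Qed.

End ShortVectors.

(** * Derivative families and polynomial approximation *)

Section LineDerivatives.
Variables (R : realType) (d : nat).
Implicit Types (g dg : 'rV[R]_d -> R) (x v : 'rV[R]_d).

Lemma is_derive_line g x v (t c : R) :
  is_derive (x + t *: v) v g c <-> is_derive t 1 (fun s => g (x + s *: v)) c.
Proof.
have e : (fun h : R => h^-1 *: (g (h *: v + (x + t *: v)) - g (x + t *: v))) =
    (fun h : R => h^-1 *: (g (x + (h *: 1 + t) *: v) - g (x + t *: v))).
  by apply/funext => h; rewrite scalerDl [h *: (1 : R)]mulr1 addrCA.
split=> -[D1 D2]; split.
- by move: D1; rewrite /derivable/= e.
- by move: D2; rewrite /derive/= e.
- by move: D1; rewrite /derivable/= e.
- by move: D2; rewrite /derive/= e.
Qed.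

Lemma is_derive_shift g x w v (c : R) :
  is_derive (x + w) v g c -> is_derive x v (fun y => g (y + w)) c.
Proof.
have e : (fun h : R => h^-1 *: (g (h *: v + (x + w)) - g (x + w))) =
    (fun h : R => h^-1 *: (g (h *: v + x + w) - g (x + w))).
  by apply/funext => h; rewrite addrA.
by move=> [D1 D2]; split; [move: D1; rewrite /derivable|move: D2; rewrite /derive] => /=; rewrite e.
Qed.

Lemma line_MVT g dg x v (h : R) : 0 <= h ->
  (forall t, 0 <= t <= h -> is_derive (x + t *: v) v g (dg (x + t *: v))) ->
  exists2 t, 0 <= t <= h & g (x + h *: v) - g x = dg (x + t *: v) * h.
Proof.
move=> h0 gD.
have D t : 0 <= t <= h -> is_derive t 1 (fun s => g (x + s *: v)) (dg (x + t *: v)).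
  by move=> /gD /is_derive_line.
have [t||t th e] := @MVT_segment R (fun s => g (x + s *: v))
    (fun t => dg (x + t *: v)) 0 h h0.
- by rewrite in_itv/= => /andP[/ltW t0 /ltW th]; apply: D; rewrite t0.
- apply: continuous_in_subspaceT => t; rewrite inE/= in_itv/= => /D[D1 _].
  exact/differentiable_continuous/derivable1_diffP.
exists t; first by rewrite in_itv/= in th.
by rewrite -[h in RHS]subr0 -e scale0r addr0.
Qed.

End LineDerivatives.

Section DerivativeFamilies.
Variables (R : realType) (d : nat).
Implicit Types (C : set 'rV[R]_d) (G : seq 'I_d -> 'rV[R]_d -> R).

(** [G s] stands for the derivative of [G [::]] along the word [s]. Keeping the whole family as data
    lets it be differenced, rescaled or re-indexed directly. *)
Definition dfam (l : nat) C G := forall s i x, (size s < l)%N -> C x ->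
  is_derive x (unitv R i) (G s) (G (i :: s) x).

Lemma cube_line (x : 'rV[R]_d) (i : 'I_d) (r t : R) :
  (forall j, 0 <= x 0 j <= r) -> 0 <= x 0 i + t <= r ->
  cube 0 r (x + t *: unitv R i).
Proof.
move=> xr xt j; rewrite !mxE add0r; have [->|ji] := eqVneq j i.
  by rewrite eqxx mulr1.
by rewrite mulr0 addr0; exact: xr.
Qed.

(* Iterated forward differences of step [h]: each one costs a factor 2 on the
   sup norm and produces, by the mean value theorem, a factor [h]. *)
Lemma dfam_difference (l : nat) (s : seq 'I_d) G (r h A : R) : 0 <= h ->
  dfam l (cube 0 r) G -> (size s <= l)%N -> (size s)%:R * h <= r -> 0 <= r ->
  (forall x, cube 0 r x -> `|G [::] x| <= A) ->
  exists2 x, cube 0 r x & h ^+ size s * `|G s x| <= 2 ^+ size s * A.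
Proof.
move=> h0; elim: s G r A => [|i s IH] G r A GD sl sr r0 GA.
  have C0 : cube (0 : 'rV[R]_d) r 0 by move=> j; rewrite !mxE add0r lexx.
  by exists 0 => //; rewrite !mul1r; exact: GA.
rewrite /= -natr1 mulrDl mul1r in sr.
have rh : 0 <= r - h by rewrite subr_ge0 (le_trans _ sr)// lerDr mulr_ge0.
have sub x t : cube 0 (r - h) x -> 0 <= t <= h -> cube 0 r (x + t *: unitv R i).
  move=> xr th; have xr' j := xr j; apply: cube_line => [j|].
    by have := xr' j; rewrite mxE; lra.
  by have := xr' i; rewrite mxE; lra.
have sub0 (x : 'rV[R]_d) : cube 0 (r - h) x -> cube 0 r x.
  by move=> xr; have := sub x 0 xr; rewrite scale0r addr0; apply; rewrite lexx.
have hh : 0 <= h <= h by rewrite h0 lexx.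
have [|||||x Cx xP] := IH (fun u x => G u (x + h *: unitv R i) - G u x) (r - h) (2 * A).
- move=> u j x ul Cx; apply: is_deriveB; last by apply: GD => //; exact: sub0.
  by apply: is_derive_shift; apply: GD => //; exact: sub.
- exact: ltnW.
- lra.
- by [].
- move=> x Cx; apply: le_trans (ler_normB _ _) _.
  by rewrite mulrDl mul1r; apply: lerD; apply: GA; [exact: sub|exact: sub0].
have [|t th e] := line_MVT (g := G s) (dg := G (i :: s)) (x := x) (v := unitv R i) h0.
  by move=> t th; apply: GD => //; exact: sub.
exists (x + t *: unitv R i); first exact: sub.
move: xP; rewrite e normrM (ger0_norm h0) /= !exprS => xP; lra.
Qed.

End DerivativeFamilies.

Section PolynomialFunctions.
Variables (R : realType) (d : nat).
Implicit Types (F P : 'rV[R]_d -> R).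

Definition monom m (e : {ffun 'I_d -> 'I_m.+1}) (x : 'rV[R]_d) : R :=
  \prod_i x 0 i ^+ e i.

Definition mpolyfun m (u : {ffun 'I_d -> 'I_m.+1} -> R) (x : 'rV[R]_d) : R :=
  \sum_e u e * monom e x.

Definition polyf m F := exists u, F = mpolyfun (m := m) u.

Lemma eq_polyf m F P : F =1 P -> polyf m F -> polyf m P.
Proof. by move=> /funext ->. Qed.

Lemma polyf_mono m (c : R) (e : 'I_d -> nat) : (forall i, e i <= m)%N ->
  polyf m (fun x => c * \prod_i x 0 i ^+ e i).
Proof.
move=> em; pose e' : {ffun 'I_d -> 'I_m.+1} := [ffun i => inord (e i)].
exists (fun e1 => if e1 == e' then c else 0); apply/funext => x.
rewrite /mpolyfun (bigD1 e')//= eqxx [X in _ = _ + X]big1 ?addr0 => [|e1 /negPf ->]; last by rewrite mul0r.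
by congr (_ * _); apply: eq_bigr => i _; rewrite ffunE inordK// ltnS.
Qed.

Lemma polyf_add m F P : polyf m F -> polyf m P -> polyf m (fun x => F x + P x).
Proof.
move=> [u ->] [v ->]; exists (fun e => u e + v e); apply/funext => x.
by rewrite /mpolyfun -big_split/=; apply: eq_bigr => e _; rewrite mulrDl.
Qed.

Lemma polyf_cst m (c : R) : polyf m (fun=> c).
Proof.
apply: eq_polyf (@polyf_mono m c (fun=> 0%N) (fun=> leq0n _)) => x.
by rewrite big1 ?mulr1.
Qed.

Lemma polyf_sum m (I : Type) (r : seq I) (F : I -> 'rV[R]_d -> R) :
  (forall i, polyf m (F i)) -> polyf m (fun x => \sum_(i <- r) F i x).
Proof.
move=> Fm; elim: r => [|i r IH].
  by apply: eq_polyf (polyf_cst m 0) => x; rewrite big_nil.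
by apply: eq_polyf (polyf_add (Fm i) IH) => x; rewrite big_cons.
Qed.

Definition trunc (m : nat) (x : 'rV[R]_d) : 'rV[R]_d :=
  \row_j if (j < m)%N then x 0 j else 0.

Lemma polyf_trunc m k F : polyf m F -> polyf m (fun x => F (trunc k x)).
Proof.
move=> [u ->]; apply: polyf_sum => e.
have [/fintype.existsP[i /andP[ik ei]]|ek] :=
    boolP [exists i : 'I_d, ~~ (i < k)%N && (e i != 0%N :> nat)].
  apply: eq_polyf (polyf_cst m 0) => x.
  by rewrite /monom (bigD1 i)//= mxE (negPf ik) expr0n (negPf ei) mul0r mulr0.
have em (i : 'I_d) : (e i <= m)%N by rewrite -ltnS.
apply: eq_polyf (polyf_mono (u e) em) => x.
congr (_ * _); apply: eq_bigr => i _; rewrite mxE; case: ifP => // /negbT ik.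
move: ek; rewrite negb_exists => /fintype.forallP/(_ i); rewrite ik/= negbK => /eqP ->.
by rewrite !expr0.
Qed.

(** Integrate term by term in the variable [i], choosing the primitive that vanishes where
    [x 0 i = 0], which is where a segment of the path in [dfam_approx] starts. *)
Lemma polyf_prim m (i : 'I_d) P : polyf m P -> exists F,
  [/\ polyf m.+1 F, forall x : 'rV[R]_d, x 0 i = 0 -> F x = 0 &
      forall x, is_derive x (unitv R i) F (P x)].
Proof.
move=> [u ->].
pose F e (x : 'rV[R]_d) := u e / (e i).+1%:R *
  \prod_j x 0 j ^+ (if j == i then (e j).+1 else e j).
exists (fun x => \sum_e F e x); split.
- apply: polyf_sum => e; apply: polyf_mono => j.
  by case: ifP => _; rewrite ?ltn_ord// ltnW// ltn_ord.
- move=> x xi; apply: big1 => e _.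
  by rewrite /F (bigD1 i)//= eqxx xi expr0n/= mul0r mulr0.
- move=> x; pose x' := x - x 0 i *: unitv R i.
  have xE : x = x' + x 0 i *: unitv R i by rewrite subrK.
  rewrite [X in is_derive X]xE; apply/is_derive_line.
  pose K e := u e / (e i).+1%:R * \prod_(j | j != i) x 0 j ^+ e j.
  pose h (e : {ffun 'I_d -> 'I_m.+1}) : R -> R := K e \*: (id ^+ (e i).+1).
  have -> : (fun s => \sum_e F e (x' + s *: unitv R i)) = \sum_e h e.
    apply/funext => s; rewrite fct_sumE; apply: eq_bigr => e _.
    rewrite /F /h /K (bigD1 i)//= eqxx mulrCA mulrC.
    rewrite /x' !mxE !eqxx/= !mulr1 subrr add0r exprfctE (eq_bigr (fun j => x 0 j ^+ e j))//.
    by move=> j /negPf ji; rewrite ji !mxE ji andbF !mulr0 subr0 addr0.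
  have -> : mpolyfun u x = \sum_e K e *: (((e i).+1%:R * x 0 i ^+ e i) *: 1).
    apply: eq_bigr => e _; rewrite /K /monom (bigD1 i)//=.
    rewrite [_ *: 1]mulr1 /GRing.scale/=; have : (e i).+1%:R != 0 :> R by rewrite pnatr_eq0.
    by move=> ei; field.
  have hD e : is_derive (x 0 i) 1 (h e) (K e *: (((e i).+1%:R * x 0 i ^+ e i) *: 1)).
    by apply: is_deriveZ; apply: is_deriveX.
  by elim/big_ind2 : _ => // [|? ? ? ? ? ?]; [exact: is_derive_cst|exact: is_deriveD].
Qed.

End PolynomialFunctions.

Section PolynomialApproximation.
Variables (R : realType) (d : nat).

(* Integrating the approximations of the first partial derivatives along the
   coordinate path [0 = trunc 0 x, trunc 1 x, ..., trunc d x = x]. *)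
Lemma dfam_approx (l : nat) (G : seq 'I_d -> 'rV[R]_d -> R) (a : seq 'I_d -> R)
    (om : R) : 0 <= om -> dfam l (cube 0 1) G ->
  (forall s x, size s = l -> cube 0 1 x -> `|G s x - a s| <= om) ->
  exists F, polyf l F /\
    forall x, cube 0 1 x -> `|G [::] x - F x| <= d%:R ^+ l * om.
Proof.
move=> om0; elim: l G a => [|l IH] G a GD Ga.
  exists (fun=> a [::]); split; first exact: polyf_cst.
  by move=> x Cx; rewrite mul1r; exact: Ga.
have /choice[P PP] : forall i, exists P, polyf l P /\
    forall x, cube 0 1 x -> `|G [:: i] x - P x| <= d%:R ^+ l * om.
  (* A word lists the latest differentiation first, so the derivatives of [G [:: i]] are indexed by
     the words [rcons s i]. *)
  move=> i; apply: (IH (fun s => G (rcons s i)) (fun s => a (rcons s i))).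
    by move=> s j x sl Cx; apply: (GD (rcons s i)); rewrite ?size_rcons.
  by move=> s x sl Cx; apply: Ga; rewrite ?size_rcons ?sl.
have /choice[H HP] : forall i, exists H,
  [/\ polyf l.+1 H, forall x : 'rV[R]_d, x 0 i = 0 -> H x = 0 &
      forall x, is_derive x (unitv R i) H (P i x)].
  by move=> i; apply: polyf_prim; case: (PP i).
(* [H i] vanishes at the start [trunc i x] of its segment, so its value at [trunc i.+1 x] is its
   increment along the segment. *)
pose S k x := G [::] 0 + \sum_(i < d | (i < k)%N) H i (trunc i.+1 x).
exists (S d); split.
  apply: polyf_add; first exact: polyf_cst.
  have -> : (fun x => \sum_(i < d | (i < d)%N) H i (trunc i.+1 x)) =
      (fun x => \sum_(i < d) H i (trunc i.+1 x)).
    by apply/funext => x; apply: eq_bigl => i; rewrite ltn_ord.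
  by apply: polyf_sum => i; apply: polyf_trunc; case: (HP i).
move=> x Cx.
have Ct k : cube 0 1 (trunc k x).
  move=> j; rewrite !mxE add0r; have := Cx j; rewrite mxE add0r.
  by case: ifP => //; rewrite lexx ler01.
have step k : (k <= d)%N ->
    `|G [::] (trunc k x) - S k x| <= k%:R * (d%:R ^+ l * om).
  elim: k => [_|k IHk kd].
    rewrite mul0r /S big_pred0// addr0.
    have -> : trunc 0 x = 0 by apply/rowP => j; rewrite !mxE.
    by rewrite subrr normr0.
  pose i := Ordinal kd.
  have xi : 0 <= x 0 i <= 1 by have := Cx i; rewrite mxE add0r.
  have xk : trunc k.+1 x = trunc k x + x 0 i *: unitv R i.
    apply/rowP => j; rewrite !mxE; have [->|ji] := eqVneq j i.
      by rewrite /= ltnSn ltnn add0r mulr1.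
    rewrite mulr0 addr0 ltnS leq_eqVlt.
    by move: ji; rewrite -val_eqE/= => /negPf ->.
  have [||t tx e] := line_MVT (g := fun y => G [::] y - H i y)
      (dg := fun y => G [:: i] y - P i y) (x := trunc k x) (v := unitv R i) (h := x 0 i).
  - by case/andP: xi.
  - move=> t tx; apply: is_deriveB; last by case: (HP i).
    apply: GD => //; apply: cube_line => [j|].
      by have := Ct k j; rewrite mxE add0r.
    rewrite mxE ltnn add0r; move: tx xi => /andP[-> /le_trans h] /andP[_ /h].
    by [].
  have H0 : H i (trunc k x) = 0 by case: (HP i) => _ + _; apply; rewrite mxE ltnn.
  have SE : S k.+1 x = S k x + H i (trunc k.+1 x).
    rewrite /S -addrA; congr (_ + _); rewrite (bigD1 i)//= addrC; congr (_ + _).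
    apply: eq_bigl => j; rewrite ltnS leq_eqVlt andb_orl.
    have [->|ji] := eqVneq j i; first by rewrite /= ltnn andbF.
    by move: ji; rewrite -val_eqE/= => /negPf ->; rewrite /= andbT.
  have -> : G [::] (trunc k.+1 x) - S k.+1 x =
     (G [::] (trunc k x) - S k x) + (G [:: i] (trunc k x + t *: unitv R i) -
        P i (trunc k x + t *: unitv R i)) * x 0 i.
    rewrite -e -xk SE H0; ring.
  rewrite -[k.+1%:R]natr1 (mulrDl k%:R 1) mul1r (le_trans (ler_normD _ _))// lerD//.
    by apply: IHk; exact: ltnW.
  case/andP: xi => xi0 xi1; rewrite normrM (ger0_norm xi0).
  apply: (@le_trans _ _ (d%:R ^+ l * om * 1)); last by rewrite mulr1.
  apply: ler_pM => //; case: (PP i) => _; apply; apply: cube_line => [j|].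
    by have := Ct k j; rewrite mxE add0r.
  by rewrite mxE ltnn add0r; move: tx xi1 => /andP[-> /le_trans h] /h.
have := step d (leqnn d); rewrite mulrA -exprS.
have -> // : trunc d x = x by apply/rowP => j; rewrite mxE ltn_ord.
Qed.

End PolynomialApproximation.

(** * Polynomials on the unit cube: bounds and interpolation *)

Section PolynomialEstimates.
Variables (R : realType) (d m : nat).
Local Notation expo := {ffun 'I_d -> 'I_m.+1}.

Lemma ler_dist_prod (I : finType) (a b : I -> R) :
  (forall i, `|a i| <= 1) -> (forall i, `|b i| <= 1) ->
  `|\prod_i a i - \prod_i b i| <= \sum_i `|a i - b i|.
Proof.
move=> a1 b1.
suff [] : `|\prod_i a i - \prod_i b i| <= \sum_i `|a i - b i| /\
    `|\prod_i b i| <= 1 by [].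
elim: (index_enum I) => [|i r [IH b_le1]]; first by rewrite !big_nil subrr normr0 normr1.
rewrite !big_cons; split; last first.
  by rewrite normrM; apply: le_trans (b1 i); rewrite ler_piMr.
set p := \prod_(j <- r) a j; set q := \prod_(j <- r) b j.
have -> : a i * p - b i * q = (a i - b i) * q + a i * (p - q) by ring.
apply: le_trans (ler_normD _ _) _; rewrite !normrM; apply: lerD.
  by rewrite ler_piMr.
by apply: le_trans IH; rewrite ler_piMl.
Qed.

Lemma monom_le1 (e : expo) (x : 'rV[R]_d) : cube 0 1 x -> `|monom e x| <= 1.
Proof.
move=> Cx; rewrite normr_prod; apply: prodr_ile1 => i _; rewrite normr_ge0 normrX.
have := Cx i; rewrite mxE add0r => /andP[x0 x1].
by rewrite ger0_norm// exprn_ile1.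
Qed.

Lemma mpolyfun_bound (u : expo -> R) (U : R) x : (forall e, `|u e| <= U) ->
  cube 0 1 x -> `|mpolyfun u x| <= (m.+1 ^ d)%:R * U.
Proof.
move=> uU Cx; apply: le_trans (ler_norm_sum _ _ _) _.
have -> : (m.+1 ^ d)%:R * U = \sum_(e : expo) U.
  by rewrite sumr_const card_ffun !card_ord mulr_natl.
apply: ler_sum => e _; rewrite normrM -[U]mulr1; apply: ler_pM => //.
exact: monom_le1.
Qed.

Lemma mpolyfun_lipschitz (u : expo -> R) (U dl : R) x y : (forall e, `|u e| <= U) ->
  cube 0 1 x -> cube 0 1 y -> (forall i, `|x 0 i - y 0 i| <= dl) ->
  `|mpolyfun u x - mpolyfun u y| <= (m.+1 ^ d)%:R * ((d * m)%:R * dl * U).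
Proof.
move=> uU Cx Cy xy; rewrite /mpolyfun -sumrB.
apply: le_trans (ler_norm_sum _ _ _) _.
have -> : (m.+1 ^ d)%:R * ((d * m)%:R * dl * U) =
    \sum_(e : expo) (d * m)%:R * dl * U.
  by rewrite sumr_const card_ffun !card_ord mulr_natl.
have le1 z i (n : nat) : cube (0 : 'rV[R]_d) 1 z -> `|z 0 i ^+ n| <= 1.
  move=> /(_ i); rewrite mxE add0r normrX => /andP[z0 z1].
  by rewrite ger0_norm// exprn_ile1.
apply: ler_sum => e _; rewrite -mulrBr normrM mulrC; apply: ler_pM => //.
apply: le_trans (ler_dist_prod _ _) _ => [i|i|]; [exact: le1|exact: le1|].
rewrite natrM -mulrA mulr_natl -[X in _ *+ X]card_ord -sumr_const.
apply: ler_sum => i _.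
have dl0 : 0 <= dl := le_trans (normr_ge0 _) (xy i).
apply: (@le_trans _ _ ((e i)%:R * dl)); last first.
  by rewrite ler_wpM2r// ler_nat -ltnS.
have -> : (e i)%:R * dl = \sum_(k < e i) dl.
  by rewrite sumr_const card_ord mulr_natl.
rewrite -[X in x 0 i ^+ X]card_ord -[X in y 0 i ^+ X]card_ord -!prodr_const.
apply: le_trans (ler_dist_prod _ _) _ => [k|k|].
- by have := le1 x i 1%N Cx.
- by have := le1 y i 1%N Cy.
- by apply: ler_sum => k _; exact: xy.
Qed.

Variable M : nat.
Hypothesis M0 : (0 < M)%N.

Definition unit_cell (b : {ffun 'I_d -> 'I_M}) : set 'rV[R]_d :=
  [set y | forall i, (b i)%:R / M%:R <= y 0 i <= (b i).+1%:R / M%:R].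

Let node (b : 'I_M) (a : 'I_m.+1) : R := (b%:R + a%:R / m.+1%:R) / M%:R.

Let node_inj b : injective (node b).
Proof.
move=> a a' /mulIf; rewrite invr_eq0 pnatr_eq0 -lt0n => /(_ M0) /addrI /mulIf.
by rewrite invr_eq0 pnatr_eq0 => /(_ isT) /eqP; rewrite eqr_nat => /eqP /val_inj.
Qed.

Let interp b : exists W : 'I_m.+1 -> 'I_m.+1 -> R,
  forall e e' : 'I_m.+1, \sum_a W a e' * node b a ^+ e = (e == e')%:R.
Proof.
pose V : 'M[R]_m.+1 := Vandermonde m.+1 (\row_a node b a).
have Vunit : V \in unitmx.
  rewrite unitmxE unitfE det_Vandermonde; apply/prodf_neq0 => i _.
  apply/prodf_neq0 => j ij; rewrite !mxE subr_eq0; apply: contraTneq ij => /node_inj ->.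
  by rewrite ltnn.
exists (fun a e' => invmx V a e') => e e'.
have /matrixP/(_ e e') := mulmxV Vunit; rewrite !mxE => <-.
by apply: eq_bigr => a _; rewrite !mxE mulrC.
Qed.

(** Lagrange interpolation on a product grid of nodes inside the cell: the coefficients are
    combinations of the values at the nodes, weighted by products of inverse Vandermonde entries.
    Summing over all cells makes [K] independent of [b]. *)
Lemma mpolyfun_coef : exists2 K : R, 0 < K &
  forall u b, exists2 y, unit_cell b y & forall e : expo, `|u e| <= K * `|mpolyfun u y|.
Proof.
have /choice[W WP] := interp.
pose K : R := \sum_(b : {ffun 'I_d -> 'I_M}) \sum_(e : expo) \sum_(al : expo)
  \prod_i `|W (b i) (al i) (e i)|.
have K0 : 0 <= K.
  by do 3!(apply: sumr_ge0 => ? _); apply: prodr_ge0 => ? _.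
exists (K + 1); first by rewrite ltr_wpDl.
move=> u b; pose y (al : expo) : 'rV[R]_d := \row_i node (b i) (al i).
(* One node serves all coefficients: the one where the polynomial is largest in absolute value. *)
pose al := [arg max_(al > [ffun=> ord0] : expo) `|mpolyfun u (y al)|]%O.
have alP al' : `|mpolyfun u (y al')| <= `|mpolyfun u (y al)|.
  by rewrite /al; case: arg_maxP => // ? _; apply.
exists (y al).
  move=> i; rewrite mxE /node ler_pM2r ?invr_gt0 ?ltr0n// ler_pM2r ?invr_gt0 ?ltr0n//.
  rewrite lerDl divr_ge0//= -[(b i).+1%:R]natr1 lerD2l ler_pdivrMr ?ltr0n// mul1r ler_nat.
  exact: ltnW.
move=> e'; apply: (@le_trans _ _ (K * `|mpolyfun u (y al)|)); last first.
  by rewrite ler_wpM2r// lerDl.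
have -> : u e' = \sum_(al : expo) (\prod_i W (b i) (al i) (e' i)) * mpolyfun u (y al).
  under eq_bigr do rewrite mulr_sumr.
  rewrite exchange_big/=.
  transitivity (\sum_e u e * (e == e')%:R).
    rewrite (bigD1 e')//= eqxx mulr1 big1 ?addr0// => e /negPf ->.
    by rewrite mulr0.
  apply: eq_bigr => e _.
  under eq_bigr do rewrite mulrCA -big_split/=.
  rewrite -mulr_sumr; congr (_ * _).
  transitivity (\prod_i (e i == e' i)%:R : R).
    have [->|ee'] := eqVneq e e'; first by rewrite big1// => i _; rewrite eqxx.
    have [i ii] : exists i, e i != e' i.
      apply/fintype.existsP; rewrite -negb_forall; apply: contra ee' => /fintype.forallP h.
      by apply/eqP/ffunP => i; apply/eqP.
    by rewrite (bigD1 i)//= (negPf ii) mul0r.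
  rewrite (eq_bigr (fun i => \sum_a W (b i) a (e' i) * node (b i) a ^+ e i)) => [|i _].
    rewrite bigA_distr_bigA/=; apply: eq_bigr => al1 _; apply: eq_bigr => i _.
    by rewrite mxE.
  by rewrite WP.
apply: le_trans (ler_norm_sum _ _ _) _.
apply: (@le_trans _ _ (\sum_(al' : expo) (\prod_i `|W (b i) (al' i) (e' i)|) *
   `|mpolyfun u (y al)|)).
  by apply: ler_sum => al' _; rewrite normrM normr_prod ler_wpM2l// prodr_ge0.
rewrite -mulr_suml ler_wpM2r//.
rewrite /K (bigD1 b)//= [X in _ <= X + _](bigD1 e')//= -addrA lerDl addr_ge0//.
  by do 2!(apply: sumr_ge0 => ? _); apply: prodr_ge0 => ? _.
by do 3!(apply: sumr_ge0 => ? _); apply: prodr_ge0 => ? _.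
Qed.

End PolynomialEstimates.

(** * Porosity of functions close to polynomials *)

Section NearPolynomial.
Variables (R : realType) (d l : nat).

Let C : set 'rV[R]_d := cube 0 1.

Lemma unit_cell_child M (b : {ffun 'I_d -> 'I_M}) (y : 'rV[R]_d) :
  unit_cell b y <-> pcube (child (0, 1) b) y.
Proof.
by split=> yb i; have := yb i; rewrite /= !mxE add0r -natr1 mulrDl mul1r [_^-1 * _]mulrC.
Qed.

Lemma near_polynomial_porous : exists M th eta,
  [/\ (1 < M)%N, 0 < th <= 1, 0 < eta &
  forall (g F : 'rV[R]_d -> R) (om : R), polyf l F ->
  (forall x, C x -> `|g x - F x| <= om) ->
  (exists2 x, C x & om <= eta * `|g x|) -> forall x, C x ->
  (forall b : {ffun 'I_d -> 'I_M}, exists2 y, pcube (child (0, 1) b) y &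
      th * `|g x| <= `|g y|) /\
  (exists b : {ffun 'I_d -> 'I_M}, forall y, pcube (child (0, 1) b) y ->
      th * `|g x| <= `|g y|)].
Proof.
(* [K0] belongs to a single cell, the whole cube. It determines [M], so large that a polynomial with
   coefficients at most [U] varies by at most [U / (2 * K0)] on a child; [K1] is then the constant
   for cells of side [1 / M]. *)
have [K0 K0gt0 K0P] := @mpolyfun_coef R d l 1 isT.
pose N : R := (l.+1 ^ d)%:R.
have N1 : 1 <= N by rewrite /N ler1n expn_gt0.
pose L : R := N * (d * l)%:R.
have L0 : 0 <= L by rewrite mulr_ge0// (le_trans _ N1).
pose M := (Num.truncn (2 * K0 * L)).+2.
have M1 : (1 < M)%N by [].
have MK : 2 * K0 * L <= M%:R.
  by apply: le_trans (ltW (truncnS_gt _)) _; rewrite ler_nat.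
have [K1 K1gt0 K1P] := @mpolyfun_coef R d l M (ltnW M1).
pose K := 4 * (K0 + K1 + 1).
have K_gt1 : 1 <= K by rewrite /K; lra.
have K_gt0 : 0 < K by exact: lt_le_trans K_gt1.
have NK : 1 <= N * K by rewrite -[1]mulr1 ler_pM.
have NK_gt0 : 0 < N * K by exact: lt_le_trans NK.
have NK2 : 0 < 2 * (N * K) by rewrite mulr_gt0.
exists M, (2 * (N * K))^-1, (2 * (N * K))^-1; split => //.
- by rewrite invr_gt0 mulr_gt0//= invf_le1 ?mulr_gt0//; lra.
- by rewrite invr_gt0 mulr_gt0.
move=> g F om [u ->] gF [x1 Cx1 om_le] x Cx.
pose U : R := \big[Num.max/0]_e `|u e|.
have uU e : `|u e| <= U by exact: le_bigmax.
have U0 : 0 <= U by exact: bigmax_ge_id.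
have Ule (a : R) : 0 <= a -> (forall e, `|u e| <= a) -> U <= a.
  by move=> a0 ua; apply: bigmax_le.
have gle y : C y -> `|g y| <= N * U + om.
  move=> Cy; rewrite -[g y](subrK (mpolyfun u y)) addrC.
  by apply: le_trans (ler_normD _ _) _; apply: lerD; [exact: mpolyfun_bound|exact: gF].
have gge y : C y -> `|mpolyfun u y| - om <= `|g y|.
  move=> Cy; rewrite lerBlDr -lerBlDl; apply: le_trans (gF y Cy).
  by rewrite distrC; exact: lerB_dist.
(* With [U] the largest coefficient of the polynomial, both [om] and [th * |g x|] turn out to be at
   most [U / K], so a point where the polynomial is at least [2 * U / K] in absolute value is good
   enough. *)
have omU : K * om <= U.
  have := gle _ Cx1.
  have : 2 * (N * K) * om <= `|g x1| by rewrite -ler_pdivlMl.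
  have om0 : 0 <= om by exact: le_trans (gF _ Cx1).
  move=> h1 h2; rewrite -(ler_pM2l (lt_le_trans ltr01 N1)) mulrA.
  have : 1 * om <= N * K * om by rewrite ler_wpM2r.
  lra.
have gx : (2 * (N * K))^-1 * `|g x| <= U / K.
  rewrite mulrC ler_pdivrMr//.
  have -> : U / K * (2 * (N * K)) = 2 * (N * U) by field; rewrite gt_eqF.
  apply: le_trans (gle _ Cx) _.
  have om0 : 0 <= om by exact: le_trans (gF _ Cx1).
  have : om <= K * om by rewrite ler_peMl.
  have : U <= N * U by rewrite ler_peMl.
  lra.
have cellC (b : {ffun 'I_d -> 'I_M}) y : pcube (child (0, 1) b) y -> C y.
  by move=> yb; apply: (child_sub M1 (Q := (0, 1)) _ yb).
have omK : om <= U / K by rewrite ler_pdivlMr// mulrC.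
split=> [b|].
  have [y /unit_cell_child yb yU] := K1P u b; exists y => //; apply: le_trans gx _.
  apply: le_trans (gge _ (cellC _ _ yb)); rewrite lerBrDr.
  have : U <= K1 * `|mpolyfun u y| by apply: Ule => //; rewrite mulr_ge0// ltW.
  rewrite -ler_pdivrMl//; apply: le_trans; apply: (@le_trans _ _ (U / K + U / K)).
    by rewrite lerD2l.
  have -> : U / K + U / K = U * (2 / K) by ring.
  rewrite mulrC ler_wpM2r// ler_pdivrMr// ler_pdivlMl// /K; lra.
(* The child to choose contains a point [y0] where the polynomial is at least [U / K0] in absolute
   value; at most half of this is lost on that child. *)
have [y0 y0b y0U] := K0P u [ffun=> ord0].
have Cy0 : C y0.
  by move=> i; have := y0b i; rewrite ffunE/= mxE mul0r add0r invr1 mulr1.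
have {}y0U : U <= K0 * `|mpolyfun u y0| by apply: Ule => //; rewrite mulr_ge0// ltW.
have [b by0] := child_cover M1 (Q := (0, 1)) Cy0.
exists b => y yb; apply: le_trans gx _; apply: le_trans (gge _ (cellC _ _ yb)).
have lip := @mpolyfun_lipschitz R d l u U M%:R^-1 y0 y uU Cy0 (cellC _ _ yb).
have {}lip : `|mpolyfun u y0 - mpolyfun u y| <= L * U / M%:R.
  apply: le_trans (lip _) _.
    move=> i; have := by0 i; have := yb i; rewrite /= !mxE mul1r ler_norml => ? ?; lra.
  by rewrite /L le_eqVlt; apply/orP; left; apply/eqP; ring.
have {}lip : `|mpolyfun u y0 - mpolyfun u y| <= U / (2 * K0).
  apply: le_trans lip _; rewrite ler_pdivrMr ?ltr0n//.
  have -> : U / (2 * K0) * M%:R = (M%:R * U) / (2 * K0) by ring.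
  rewrite ler_pdivlMr ?mulr_gt0//.
  have -> : L * U * (2 * K0) = 2 * K0 * L * U by ring.
  by rewrite ler_wpM2r.
have := le_trans (lerB_dist _ _) lip.
rewrite -ler_pdivrMl// in y0U.
have e1 : U / (2 * K0) = K0^-1 * U / 2 by field; rewrite gt_eqF.
have e2 : U / K <= K0^-1 * U / 4.
  have -> : K0^-1 * U / 4 = U / (4 * K0) by field; rewrite gt_eqF.
  by rewrite ler_wpM2l// lef_pV2 ?posrE ?mulr_gt0// /K; lra.
rewrite e1; lra.
Qed.

End NearPolynomial.

(** * Porosity of affine combinations *)

Section AffineCombinations.
Variables (R : realType) (d n l : nat).
Variables (V : set 'rV[R]_d) (f : 'rV[R]_d -> 'rV[R]_n) (x0 : 'rV[R]_d).
Implicit Types (c : 'I_n -> R) (s : seq 'I_d).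

Definition affine_comb (c0 : R) c (x : 'rV[R]_d) : R := c0 + \sum_j c j * f x 0 j.

Definition comb_deriv c s (x : 'rV[R]_d) : R := \sum_j c j * pderiv s f x 0 j.

Lemma is_derive_comb c (F : 'rV[R]_d -> 'rV[R]_n) x v : derivable F x v ->
  is_derive x v (fun y => \sum_j c j * F y 0 j) (\sum_j c j * ('D_v F x) 0 j).
Proof.
move=> DF.
have -> : (fun y => \sum_j c j * F y 0 j) = \sum_j (c j \*: (fun y => F y 0 j)).
  by apply/funext => y; rewrite fct_sumE.
apply: is_derive_sum => j; apply: is_deriveZ; split.
  by have /derivable_mxP := DF; apply.
by rewrite derive_mx// mxE.
Qed.

Lemma is_derive_rescale (g : 'rV[R]_d -> R) (p y v : 'rV[R]_d) (r a : R) :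
  is_derive (p + r *: y) v g a -> is_derive y v (fun z => g (p + r *: z)) (r * a).
Proof.
move=> gD; rewrite -[X in is_derive X](addr0 y) -(scale0r v); apply/is_derive_line.
have -> : (fun s : R => g (p + r *: (y + s *: v))) =
    (fun t => g ((p + r *: y) + t *: v)) \o ( *:%R r : R -> R).
  by apply/funext => s; rewrite /= scalerDr scalerA addrA.
rewrite mulrC; apply: is_derive1_comp.
  by rewrite scaler0; apply/is_derive_line; rewrite scale0r addr0.
rewrite -[X in is_derive _ _ _ X]mulr1.
exact: (is_deriveZ r).
Qed.

(** The derivative family of the affine combination read on the unit cube: the chain rule gives the
    power of [r], and [c0] survives only for the empty word. *)
Definition rescaled (c0 : R) c (p : 'rV[R]_d) (r : R) s (y : 'rV[R]_d) : R :=
  r ^+ size s * comb_deriv c s (p + r *: y) + (if s is [::] then c0 else 0).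

Lemma rescaled_dfam (c0 : R) c p (r : R) : Cl_on l V f -> 0 < r -> cube p r `<=` V ->
  dfam l (cube 0 1) (rescaled c0 c p r).
Proof.
move=> [fD _] r0 pV s i x sl Cx.
have Vx : V (p + r *: x).
  apply: pV => j; have := Cx j; rewrite !mxE add0r => /andP[x0' x1'].
  by rewrite lerDl mulr_ge0 ?(ltW r0)//= lerD2l ler_piMr// ltW.
have -> : rescaled c0 c p r (i :: s) x =
    r ^+ size s * (r * comb_deriv c (i :: s) (p + r *: x)) + 0.
  by rewrite /rescaled exprSr mulrA.
apply: is_deriveD; apply: is_deriveZ.
by apply: is_derive_rescale; apply: is_derive_comb; exact: fD.
Qed.

(** Each basis vector is a combination of derivatives of [f] at [x0], so [c i] is the same
    combination of the numbers [comb_deriv c s x0], which cannot all be small compared with it. *)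
Lemma nondegenerate_comb : nondegenerate_at l f x0 -> exists2 kap : R, 0 < kap &
  forall c i, c i != 0 -> (forall j, `|c j| <= `|c i|) ->
  exists2 s, (0 < size s <= l)%N & kap * `|c i| <= `|comb_deriv c s x0|.
Proof.
move=> fnd.
have /choice[a aP] : forall i : 'I_n, exists a : forall j : 'I_l, j.+1.-tuple 'I_d -> R,
    delta_mx 0 i = \sum_(j < l) \sum_(s : j.+1.-tuple 'I_d) a j s *: pderiv s f x0.
  move=> i; have : (delta_mx 0 i : 'rV[R]_n) \in fullv by rewrite memvf.
  rewrite -fnd => /memv_sumP[vs vsin ->].
  have bP : forall j : 'I_l, exists b : j.+1.-tuple 'I_d -> R,
      vs j = \sum_(s : j.+1.-tuple 'I_d) b s *: pderiv s f x0.
    move=> j; have /memv_sumP[ws wsin ->] := vsin j isT.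
    have /choice[b bP] : forall s : j.+1.-tuple 'I_d, exists b, ws s = b *: pderiv s f x0.
      by move=> s; exact/vlineP/wsin.
    by exists b; apply: eq_bigr => s _; exact: bP.
  exists (fun j => sval (cid (bP j))); apply: eq_bigr => j _.
  exact: svalP (cid (bP j)).
pose B : R := 1 + \sum_i \sum_(j < l) \sum_(s : j.+1.-tuple 'I_d) `|a i j s|.
have B0 : 0 < B by rewrite ltr_pwDl//; do 3!(apply: sumr_ge0 => ? _).
exists B^-1; first by rewrite invr_gt0.
move=> c i ci0 cmax; apply: contrapT => nex.
have lt j (s : j.+1.-tuple 'I_d) : (j < l)%N ->
    `|comb_deriv c s x0| <= B^-1 * `|c i|.
  move=> jl; rewrite leNgt; apply/negP => h; apply: nex; exists s; last exact: ltW.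
  by rewrite size_tuple.
have ci : c i = \sum_(j < l) \sum_(s : j.+1.-tuple 'I_d) a i j s * comb_deriv c s x0.
  transitivity (\sum_k c k * (delta_mx 0 i : 'rV[R]_n) 0 k).
    rewrite (bigD1 i)//= mxE !eqxx mulr1 big1 ?addr0// => k /negPf ki.
    by rewrite mxE ki andbF mulr0.
  rewrite aP; under eq_bigr do rewrite summxE mulr_sumr.
  rewrite exchange_big/=; apply: eq_bigr => j _.
  under eq_bigr do rewrite summxE mulr_sumr.
  rewrite exchange_big/=; apply: eq_bigr => s _.
  by rewrite mulr_sumr; apply: eq_bigr => k _; rewrite mxE mulrCA.
have : `|c i| <= (B - 1) * (B^-1 * `|c i|).
  rewrite {1}ci; apply: le_trans (ler_norm_sum _ _ _) _.
  apply: (@le_trans _ _ ((\sum_(j < l) \sum_(s : j.+1.-tuple 'I_d) `|a i j s|) * (B^-1 * `|c i|))).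
    rewrite mulr_suml; apply: ler_sum => j _; apply: le_trans (ler_norm_sum _ _ _) _.
    rewrite mulr_suml; apply: ler_sum => s _.
    by rewrite normrM ler_wpM2l// lt.
  rewrite ler_wpM2r ?mulr_ge0 ?invr_ge0 ?(ltW B0)// /B addrC addKr.
  rewrite [leRHS](bigD1 i)//= lerDl.
  by do 3!(apply: sumr_ge0 => ? _).
apply/negP; rewrite -ltNge mulrA mulrBl mul1r divff ?gt_eqF// mulrBl mul1r.
by rewrite ltrBlDr ltrDl mulr_gt0 ?invr_gt0 ?normr_gt0.
Qed.

End AffineCombinations.

Section PorosityOfAffineCombinations.
Variables (R : realType) (d n l : nat).
Variables (V : set 'rV[R]_d) (f : 'rV[R]_d -> 'rV[R]_n) (x0 : 'rV[R]_d).

Lemma cube_rescale (p x : 'rV[R]_d) (r : R) : 0 < r ->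
  cube 0 1 x <-> cube p r (p + r *: x).
Proof.
move=> r0; rewrite /cube /=; split=> Cx i; have := Cx i; rewrite !mxE add0r lerDl lerD2l.
  by rewrite pmulr_rge0// ger_pMr.
by rewrite pmulr_rge0// ger_pMr.
Qed.

Lemma child_rescale M (b : {ffun 'I_d -> 'I_M}) (p x : 'rV[R]_d) (r : R) :
  0 < r ->
  pcube (child (0, 1) b) x <-> pcube (child (p, r) b) (p + r *: x).
Proof.
move=> r0; rewrite /pcube /cube /=; split=> Cx i; have := Cx i;
  rewrite !mxE add0r !mul1r -!addrA !lerD2l -mulrA -!mulrDr !ler_pM2l//.
Qed.

Lemma porous_rescale M th (p : 'rV[R]_d) (r : R) (g : 'rV[R]_d -> R) :
  0 < r ->
  (forall x, cube 0 1 x ->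
    (forall b : {ffun 'I_d -> 'I_M}, exists2 y, pcube (child (0, 1) b) y &
      th * `|g (p + r *: x)| <= `|g (p + r *: y)|) /\
    (exists b : {ffun 'I_d -> 'I_M}, forall y, pcube (child (0, 1) b) y ->
      th * `|g (p + r *: x)| <= `|g (p + r *: y)|)) ->
  forall x, cube p r x ->
    (forall b : {ffun 'I_d -> 'I_M}, exists2 y, pcube (child (p, r) b) y &
      th * `|g x| <= `|g y|) /\
    (exists b : {ffun 'I_d -> 'I_M}, forall y, pcube (child (p, r) b) y ->
      th * `|g x| <= `|g y|).
Proof.
move=> r0 gP x Cx.
have unscale y : p + r *: (r^-1 *: (y - p)) = y.
  by rewrite scalerA divff ?gt_eqF// scale1r addrC subrK.
have [] := gP (r^-1 *: (x - p)); first by apply/(cube_rescale p _ r0); rewrite unscale.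
rewrite unscale => h1 [b h2]; split.
  move=> b'; have [y yb yP] := h1 b'; exists (p + r *: y) => //.
  exact/child_rescale.
exists b => y yb; have := h2 (r^-1 *: (y - p)); rewrite unscale; apply.
by apply/(child_rescale b p _ r0); rewrite unscale.
Qed.

Section OneCube.
Variables (del kap0 : R) (p : 'rV[R]_d) (r : R) (c0 : R) (c : 'I_n -> R) (i : 'I_n).
Hypotheses (fCl : Cl_on l V f) (del0 : 0 <= del) (r0 : 0 < r) (pV : cube p r `<=` V).
Hypothesis fdel : forall (s : seq 'I_d) x j, (size s <= l)%N -> cube p r x ->
  `|pderiv s f x 0 j - pderiv s f x0 0 j| <= del.
Hypothesis cmax : forall j, `|c j| <= `|c i|.

Lemma comb_deriv_osc (s : seq 'I_d) x : (size s <= l)%N -> cube p r x ->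
  `|comb_deriv f c s x - comb_deriv f c s x0| <= n%:R * del * `|c i|.
Proof.
move=> sl Cx; rewrite /comb_deriv -sumrB; apply: le_trans (ler_norm_sum _ _ _) _.
rewrite -mulrA mulr_natl -[X in _ *+ X]card_ord -sumr_const.
by apply: ler_sum => j _; rewrite -mulrBr normrM mulrC ler_pM// fdel.
Qed.

Lemma affine_comb_approx : (0 < l)%N -> exists F, polyf l F /\
  forall y, cube 0 1 y -> `|affine_comb f c0 c (p + r *: y) - F y| <=
    d%:R ^+ l * (r ^+ l * (n%:R * del * `|c i|)).
Proof.
move=> l0.
have [||F [Fl FP]] := dfam_approx
  (a := fun s => r ^+ size s * comb_deriv f c s x0)
  (om := r ^+ l * (n%:R * del * `|c i|)) _ (rescaled_dfam c0 c fCl r0 pV).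
- by rewrite !mulr_ge0 ?exprn_ge0 ?(ltW r0).
- move=> s x sl Cx; rewrite /rescaled.
  have -> : (if s is [::] then c0 else 0) = 0.
    by case: s sl l0 => //= <-.
  rewrite addr0 -mulrBr sl normrM ger0_norm ?exprn_ge0 ?(ltW r0)//.
  rewrite ler_wpM2l ?exprn_ge0 ?(ltW r0)// comb_deriv_osc ?sl//.
  exact/cube_rescale.
exists F; split=> // y Cy; have := FP y Cy.
by rewrite /rescaled /affine_comb /= mul1r [c0 + _]addrC.
Qed.

(** If the combination were smaller throughout the cube, [dfam_difference] with step [1 / l] would
    make its derivative along [s] small somewhere, but that derivative is at least
    [kap0 / 2 * |c i|] on the whole cube. The other factor 2 in [kap0 / 4] makes the contradiction
    strict. *)
Lemma affine_comb_sup (s : seq 'I_d) : (0 < size s <= l)%N -> r <= 1 ->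
  c i != 0 -> 0 < kap0 -> n%:R * del <= kap0 / 2 ->
  kap0 * `|c i| <= `|comb_deriv f c s x0| ->
  exists2 y, cube 0 1 y &
    kap0 / 4 / (2 * l)%:R ^+ l * `|c i| * r ^+ l <= `|affine_comb f c0 c (p + r *: y)|.
Proof.
move=> /andP[s0 sl] r1 ci0 kap00 delk cs.
apply: contrapT => nex.
have l0 : (0 < l)%N by exact: leq_trans sl.
have lR : (0 : R) < l%:R by rewrite ltr0n.
have ci : 0 < `|c i| by rewrite normr_gt0.
set A := _ * r ^+ l in nex.
have [||||x Cx] := @dfam_difference _ _ l s _ 1 l%:R^-1 A _ (rescaled_dfam c0 c fCl r0 pV) sl.
- by rewrite invr_ge0 ltW.
- by rewrite ler_pdivrMr// mul1r ler_nat.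
- exact: ler01.
- move=> x Cx; rewrite leNgt; apply/negP => lt; apply: nex; exists x => //.
  by move: lt => /ltW; rewrite /rescaled /affine_comb /= mul1r [c0 + _]addrC.
have -> : rescaled f c0 c p r s x = r ^+ size s * comb_deriv f c s (p + r *: x).
  by rewrite /rescaled; case: (s) s0 => //= *; rewrite addr0.
rewrite normrM ger0_norm ?exprn_ge0 ?(ltW r0)//.
have big : kap0 / 2 * `|c i| <= `|comb_deriv f c s (p + r *: x)|.
  have := comb_deriv_osc sl ((cube_rescale p x r0).1 Cx).
  have := lerB_dist (comb_deriv f c s x0) (comb_deriv f c s (p + r *: x)).
  rewrite distrC => h1 h2.
  have : n%:R * del * `|c i| <= kap0 / 2 * `|c i| by rewrite ler_wpM2r// ltW.
  lra.
apply/negP; rewrite -ltNge.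
have h1 : r ^+ l <= r ^+ size s by rewrite ler_wiXn2l// ltW.
have h2 : (l%:R ^+ l)^-1 <= (l%:R : R)^-1 ^+ size s.
  rewrite exprVn lef_pV2 ?posrE ?exprn_gt0//.
  by rewrite ler_weXn2l// ler1n.
have h3 : (2 : R) ^+ size s <= 2 ^+ l by rewrite ler_weXn2l// ler1n.
apply: (@le_lt_trans _ _ (2 ^+ l * A)).
  rewrite ler_wpM2r// /A mulr_ge0// ?exprn_ge0 ?(ltW r0)// mulr_ge0// divr_ge0//.
  by rewrite divr_ge0// ltW.
apply: (@lt_le_trans _ _ ((l%:R ^+ l)^-1 * (r ^+ l * (kap0 / 2 * `|c i|)))); last first.
  have rl0 : 0 <= r ^+ l by rewrite exprn_ge0// ltW.
  have k0 : 0 <= kap0 / 2 * `|c i| by rewrite mulr_ge0// divr_ge0// ltW.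
  by apply: ler_pM => //; [exact: mulr_ge0|exact: ler_pM].
rewrite /A natrM exprMn.
have rl : 0 < r ^+ l by rewrite exprn_gt0.
have ll : 0 < (l%:R : R) ^+ l by rewrite exprn_gt0.
have tl : 0 < (2 : R) ^+ l by rewrite exprn_gt0.
rewrite [ltLHS](_ : _ = (l%:R ^+ l)^-1 * (r ^+ l * (kap0 / 2 * `|c i|)) / 2).
  by rewrite ltr_pdivrMr// ltr_pMr ?ltr1n// !mulr_gt0 ?invr_gt0.
move: (2 ^+ l) (l%:R ^+ l) tl ll => a b a0 b0.
by field; rewrite !gt_eqF.
Qed.

End OneCube.
End PorosityOfAffineCombinations.

(** * A neighbourhood on which all affine combinations are porous *)

Section GoodNeighbourhood.
Variables (R : realType) (d n l : nat).
Variables (V : set 'rV[R]_d) (f : 'rV[R]_d -> 'rV[R]_n) (x0 : 'rV[R]_d).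
Hypotheses (hn : (0 < n)%N) (oV : open V) (Vx0 : V x0) (fCl : Cl_on l V f)
  (fnd : nondegenerate_at l f x0).

Definition ccube (x : 'rV[R]_d) (r : R) : 'rV[R]_d * R := (x - const_mx r, r *+ 2).

Lemma nbhs_ccube (A : set 'rV[R]_d) : nbhs x0 A -> exists2 r, 0 < r <= 1 / 2 &
  pcube (ccube x0 r) `<=` A.
Proof.
(* The bound [1 / 2] on the half-side keeps the sides of all subcubes at most 1. *)
move=> /nbhs_ballP[e /= e0 eA]; exists (Num.min (1 / 2) (e / 2)).
  by rewrite lt_min ge_min lexx !divr_gt0.
move=> x Cx; apply: eA; split=> // i j; rewrite !ord1.
have := Cx j; rewrite /= !mxE /ball/= => h.
have : Num.min (1 / 2) (e / 2) <= e / 2 by rewrite ge_min lexx orbT.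
rewrite mulr2n in h; move: (Num.min _ _) h => m h mle.
by rewrite ltr_norml; lra.
Qed.

Lemma ccube_nbhs r : 0 < r -> nbhs x0 (pcube (ccube x0 r)).
Proof.
move=> r0; apply/nbhs_ballP; exists r => //= x [_ xr] j.
have := xr 0 j; rewrite /ball/= ltr_norml !mxE mulr2n => ?; lra.
Qed.

Lemma nbhs_deriv_close (del : R) : 0 < del ->
  nbhs x0 (fun x => forall (s : seq 'I_d) j, (size s <= l)%N ->
    `|pderiv s f x 0 j - pderiv s f x0 0 j| <= del).
Proof.
move=> del0.
(* Words of length at most [l] form the finite type [l.-bseq], so only finitely many neighbourhoods
   are intersected. *)
have H : \forall x \near nbhs x0, (forall sj : l.-bseq 'I_d * 'I_n,
    `|pderiv sj.1 f x 0 sj.2 - pderiv sj.1 f x0 0 sj.2| <= del).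
  apply: filter_forall => -[s j] /=.
  have fs : {for x0, continuous (pderiv s f)} by apply: fCl.2 => //; exact: size_bseq.
  have fsj : (fun x => pderiv s f x 0 j) @ x0 --> pderiv s f x0 0 j.
    exact: (continuous_comp fs (@coord_continuous _ _ _ 0 j _)).
  by move/cvgrPdist_le : fsj => /(_ _ del0); apply: filterS => x; rewrite distrC.
apply: filterS H => x H s j sl.
exact: (H (Bseq sl, j)).
Qed.

(** On each subcube, [affine_comb_sup] bounds the supremum below by a constant times the largest
    [|c j|] times the side to the power [l], and [affine_comb_approx] gives a polynomial error that
    is a small multiple of the same quantity; so [near_polynomial_porous] applies at every scale. *)
Lemma affine_comb_porous : exists M th r kap,
  [/\ [/\ (0 < d)%N, (1 < M)%N, 0 < th <= 1, 0 < r & 0 < kap],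
    pcube (ccube x0 r) `<=` V,
    forall c0 c, porous M (pcube (ccube x0 r)) th (affine_comb f c0 c) &
    forall c0 c i, exists2 x, pcube (ccube x0 r) x &
      kap * `|c i| <= `|affine_comb f c0 c x|].
Proof.
have [kap0 kap00 ndP] := nondegenerate_comb fnd.
pose i0 := Ordinal hn.
have argmax (c : 'I_n -> R) : exists i, forall j, `|c j| <= `|c i|.
  exists [arg max_(i > i0) `|c i|]%O; by case: arg_maxP => // i _ h j; exact: h.
(* Nondegeneracy applied to a nonzero combination yields a nonempty word, which forces [l] and [d]
   to be positive. *)
have [s0 /andP[s00 s0l] _] : exists2 s : seq 'I_d, (0 < size s <= l)%N &
    kap0 * `|1| <= `|comb_deriv f (fun=> 1) s x0|.
  by apply: (ndP (fun=> 1) i0) => //; exact: oner_neq0.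
have l0 : (0 < l)%N by exact: leq_trans s0l.
have d0 : (0 < d)%N by case: s0 s00 {s0l} => // i s _; exact: leq_ltn_trans (ltn_ord i).
have [M [th [eta [M1 th01 eta0 npP]]]] := near_polynomial_porous R d l.
pose kap1 := kap0 / 4 / (2 * l)%:R ^+ l.
have kap10 : 0 < kap1.
  by rewrite /kap1 divr_gt0 ?divr_gt0// exprn_gt0// ltr0n muln_gt0.
(* The first bound keeps the derivative along the chosen word above [kap0 / 2 * |c i|]; the second
   makes the polynomial error at most [eta] times the supremum. *)
pose del := Num.min (kap0 / 2 / n%:R) (eta * kap1 / (d%:R ^+ l * n%:R)).
have nR : (0 : R) < n%:R by rewrite ltr0n.
have dR : (0 : R) < d%:R ^+ l by rewrite exprn_gt0// ltr0n.
have del0 : 0 < del by rewrite lt_min; apply/andP; split;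
  rewrite divr_gt0// ?divr_gt0// mulr_gt0.
have del1 : n%:R * del <= kap0 / 2.
  by rewrite mulrC -ler_pdivlMr// ge_min lexx.
have del2 : d%:R ^+ l * (n%:R * del) <= eta * kap1.
  by rewrite mulrA mulrC -ler_pdivlMr ?mulr_gt0// ge_min lexx orbT.
have [r /andP[r0 r12] rP] := nbhs_ccube (filterI (open_nbhs_nbhs (conj oV Vx0)) (nbhs_deriv_close del0)).
set X := pcube (ccube x0 r) in rP *.
have XV : X `<=` V by move=> x /rP[].
have Xdel s x j : (size s <= l)%N -> X x ->
    `|pderiv s f x 0 j - pderiv s f x0 0 j| <= del.
  by move=> sl /rP[_]; apply.
have side Q : subcube X Q -> Q.2 <= 1.
  move=> [Q0 QX]; pose j := Ordinal d0.
  have /QX/(_ j) : pcube Q Q.1 by move=> k; rewrite lexx lerDl ltW.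
  have /QX/(_ j) : pcube Q (Q.1 + const_mx Q.2).
    by move=> k; rewrite !mxE lexx lerDl ltW.
  rewrite /ccube /= !mxE mulr2n => ? ?; lra.
have sup Q c0 c i : subcube X Q -> (forall j, `|c j| <= `|c i|) -> c i != 0 ->
    exists2 y, cube 0 1 y &
      kap1 * `|c i| * Q.2 ^+ l <= `|affine_comb f c0 c (Q.1 + Q.2 *: y)|.
  move=> XQ cmax ci0; have [s sl cs] := ndP c i ci0 cmax.
  have [Q0 QX] := XQ.
  exact: (affine_comb_sup c0 fCl Q0 (subset_trans QX XV)
    (fun s' x j s'l Qx => Xdel s' x j s'l (QX x Qx)) cmax sl (side Q XQ) ci0 kap00 del1 cs).
exists M, th, r, (Num.min 1 (kap1 * (r *+ 2) ^+ l)); split => //.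
- by split => //; rewrite lt_min ltr01 mulr_gt0// exprn_gt0// mulr2n addr_gt0.
- move=> c0 c [p q] x XQ Qx; have [i cmax] := argmax c.
  have [ci0|ci0] := eqVneq (c i) 0.
    have gE y : affine_comb f c0 c y = c0.
      rewrite /affine_comb big1 ?addr0// => j _.
      by have := cmax j; rewrite ci0 normr0 normr_le0 => /eqP ->; rewrite mul0r.
    case/andP: th01 => th0 th1.
    split=> [b|]; last by exists [ffun=> Ordinal (ltnW M1)] => y _; rewrite !gE ler_piMl.
    exists (child (p, q) b).1; last by rewrite !gE ler_piMl.
    by move=> k; rewrite lexx lerDl; have [] := subcube_child M1 b XQ => /ltW.
  have [q0 QX] := XQ; apply: (porous_rescale q0) => // y Cy.
  have [F [Fl FP]] := affine_comb_approx (x0 := x0) (del := del) c0 fCl (ltW del0) q0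
     (subset_trans QX XV) (fun s x j sl Qx => Xdel s x j sl (QX x Qx)) cmax l0.
  apply: (npP (fun y => affine_comb f c0 c (p + q *: y)) F _ Fl FP) => //.
  have [z Cz zP] := sup _ c0 c i XQ cmax ci0; exists z => //.
  apply: le_trans (ler_wpM2l (ltW eta0) zP).
  have -> : d%:R ^+ l * (q ^+ l * (n%:R * del * `|c i|)) =
    d%:R ^+ l * (n%:R * del) * (`|c i| * q ^+ l) by ring.
  have -> : eta * (kap1 * `|c i| * (p, q).2 ^+ l) = eta * kap1 * (`|c i| * q ^+ l) by rewrite /=; ring.
  by rewrite ler_wpM2r// mulr_ge0// exprn_ge0// ltW.
- move=> c0 c i; have [i1 cmax] := argmax c.
  have XX : subcube X (ccube x0 r) by split => //=; rewrite mulr2n addr_gt0.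
  have [ci0|ci0] := eqVneq (c i1) 0.
    exists x0; first exact: (nbhs_singleton (ccube_nbhs r0)).
    by have := cmax i; rewrite ci0 normr0 normr_le0 => /eqP ->; rewrite normr0 mulr0.
  have [y Cy yP] := sup _ c0 c i1 XX cmax ci0.
  exists ((ccube x0 r).1 + (ccube x0 r).2 *: y); first by apply/cube_rescale => //; case: XX.
  apply: le_trans yP => /=.
  have -> : kap1 * `|c i1| * (r *+ 2) ^+ l = kap1 * (r *+ 2) ^+ l * `|c i1| by ring.
  have k0 : 0 <= kap1 * (r *+ 2) ^+ l.
    by rewrite mulr_ge0 ?(ltW kap10)// exprn_ge0// mulrn_wge0// ltW.
  by apply: ler_pM => //; rewrite ?le_min ?ler01// ge_min lexx orbT.
Qed.

End GoodNeighbourhood.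

(** * Minors along the flow *)

Section FlowMatrices.
Variables (R : realType) (n : nat).
Implicit Types (t : R) (y : 'rV[R]_n).

(* Row vectors [v] of the lattice Z^k correspond to [v *m flow_mx t y]. *)
Definition flow_mx t y : 'M[R]_n.+1 := (gt n t *m Ly y)^T.

Lemma Ly_00 y : Ly y ord0 ord0 = 1.
Proof.
rewrite mxE; case: splitP => // a _; rewrite mxE; case: splitP => // b _.
by rewrite mxE !ord1.
Qed.

Lemma Ly_0S y j : Ly y ord0 (lift ord0 j) = y 0 j.
Proof.
rewrite mxE; case: splitP => // a _; rewrite mxE.
case: splitP => [[[]]//|b /= jb]; rewrite !ord1; congr (y _ _); apply: val_inj.
by move: jb; rewrite /bump leq0n !add1n => -[].
Qed.

Lemma Ly_S0 y j : Ly y (lift ord0 j) ord0 = 0.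
Proof.
rewrite mxE; case: splitP => [[[]]//|a _]; rewrite mxE; case: splitP => // b _.
by rewrite mxE.
Qed.

Lemma Ly_SS y i j : Ly y (lift ord0 i) (lift ord0 j) = (i == j)%:R.
Proof.
rewrite mxE; case: splitP => [[[]]//|a /= ia]; rewrite mxE.
case: splitP => [[[]]//|b /= jb]; rewrite mxE; congr (_%:R); congr (nat_of_bool (_ == _)).
  by apply: val_inj; move: ia; rewrite /bump leq0n !add1n => -[].
by apply: val_inj; move: jb; rewrite /bump leq0n !add1n => -[].
Qed.

Lemma flow_mxE t y a b : flow_mx t y a b = gt n t b b * Ly y b a.
Proof.
rewrite mxE mxE (bigD1 b)//= big1 ?addr0// => c cb.
by rewrite mxE eq_sym (negPf cb) mul0r.
Qed.

Lemma mul_flow_mx0 t y j (A : 'M[R]_(j, n.+1)) i :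
  (A *m flow_mx t y) i ord0 =
    expR t * (A i ord0 + \sum_m A i (lift ord0 m) * y 0 m).
Proof.
rewrite mxE big_ord_recl flow_mxE Ly_00 mulr1 mxE !eqxx mulrDr mulrC; congr (_ + _).
rewrite mulr_sumr; apply: eq_bigr => m _.
by rewrite flow_mxE Ly_0S mxE !eqxx mulrCA.
Qed.

Lemma mul_flow_mxS t y j (A : 'M[R]_(j, n.+1)) i b : b != ord0 ->
  (A *m flow_mx t y) i b = expR (- t / n%:R) * A i b.
Proof.
case: (unliftP ord0 b) => [b' ->|->]; last by rewrite eqxx.
move=> b0; rewrite mxE big_ord_recl flow_mxE Ly_S0 mulr0 mulr0 add0r.
rewrite (bigD1 b')//= big1 ?addr0 => [|m mb].
  by rewrite flow_mxE Ly_SS eqxx mulr1 mxE eqxx (negPf b0) mulrC.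
by rewrite flow_mxE Ly_SS eq_sym (negPf mb) !mulr0.
Qed.

Lemma det_flow_mx t y : (0 < n)%N -> \det (flow_mx t y) = 1.
Proof.
move=> n0; rewrite det_tr det_mulmx.
have -> : \det (Ly y) = 1.
  by rewrite /Ly (det_ublock (1 : 'M[R]_1)) !det1 mulr1.
have -> : gt n t = diag_mx (\row_j if j == ord0 then expR t else expR (- t / n%:R)).
  apply/matrixP => i j; rewrite !mxE; case: eqVneq => [->|_].
    by rewrite mulr1n.
  by rewrite mulr0n.
rewrite mulr1 det_diag big_ord_recl mxE eqxx.
rewrite (eq_bigr (fun=> expR (- t / n%:R))); last by move=> i _; rewrite mxE.
rewrite prodr_const card_ord -expRM_natl -expRD mulrC divfK ?subrr ?expR0//.
by rewrite pnatr_eq0 -lt0n.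
Qed.

(* Only the column of index 0 of [A *m flow_mx t y] depends on [y]. *)
Lemma minor_flow_mx t y j (A : 'M[R]_(j.+1, n.+1)) (h : 'I_j.+1 -> 'I_n.+1) a0 :
  h a0 = ord0 -> (forall a, a != a0 -> h a != ord0) ->
  let D m := expR t * expR (- t / n%:R) ^+ j *
    \det (colsub [eta h with a0 |-> m] A) in
  \det (colsub h (A *m flow_mx t y)) = D ord0 + \sum_m D (lift ord0 m) * y 0 m.
Proof.
move=> ha0 ha D.
(* Cofactors along the column [a0] only involve the other columns, each a column of [A] scaled by
   [expR (- t / n%:R)]. *)
have cof m i : cofactor (colsub h (A *m flow_mx t y)) i a0 =
    expR (- t / n%:R) ^+ j * cofactor (colsub [eta h with a0 |-> m] A) i a0.
  rewrite /cofactor mulrCA; congr (_ * _); rewrite -detZ; congr (\det _).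
  apply/matrixP => r c; do 3!rewrite [LHS]mxE; rewrite mul_flow_mxS; last first.
    by apply: ha; rewrite eq_sym; exact: neq_lift.
  by rewrite !mxE /= eq_sym (negPf (neq_lift _ _)).
have DE m : D m = expR t * \sum_i A i m * cofactor (colsub h (A *m flow_mx t y)) i a0.
  rewrite /D -mulrA; congr (_ * _); rewrite (expand_det_col _ a0) mulr_sumr.
  by apply: eq_bigr => i _; rewrite (cof m) mxE /= eqxx mulrCA.
under eq_bigr do rewrite DE -mulrA mulr_suml.
rewrite (expand_det_col _ a0) DE -mulr_sumr -mulrDr exchange_big/= -big_split/= mulr_sumr.
apply: eq_bigr => i _; rewrite [colsub _ _ _ _]mxE ha0 mul_flow_mx0 -mulrA; congr (_ * _).
rewrite mulrDl mulr_suml; congr (_ + _); apply: eq_bigr => m _.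
by rewrite mulrAC.
Qed.

(** The column of index 0 is selected never, once, or more than once: the minor is respectively
    constant, given by [minor_flow_mx], or zero. *)
Lemma minor_flow_mx_affine t j (A : 'M[R]_(j, n.+1)) (h : 'I_j -> 'I_n.+1) :
  exists c0 c, forall y, \det (colsub h (A *m flow_mx t y)) = c0 + \sum_m c m * y 0 m.
Proof.
case: j A h => [|j] A h.
  by exists 1, (fun=> 0) => y; rewrite det_mx00 big1 ?addr0// => m _; rewrite mul0r.
have [[a0 ha0]|noa] := pselect (exists a, h a = ord0); last first.
  exists (\det (expR (- t / n%:R) *: colsub h A)), (fun=> 0) => y.
  rewrite big1 ?addr0 => [|m _]; last by rewrite mul0r.
  congr (\det _); apply/matrixP => r c; rewrite [LHS]mxE mul_flow_mxS ?mxE//.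
  by apply/eqP => hc; apply: noa; exists c.
have [[a a_a0 ha]|uniq_a] := pselect (exists2 a, a != a0 & h a = ord0); last first.
  exists (expR t * expR (- t / n%:R) ^+ j * \det (colsub [eta h with a0 |-> ord0] A)),
   (fun m => expR t * expR (- t / n%:R) ^+ j * \det (colsub [eta h with a0 |-> lift ord0 m] A)).
  move=> y; apply: minor_flow_mx => // a aa0; apply/eqP => ha; apply: uniq_a.
  by exists a.
exists 0, (fun=> 0) => y; rewrite big1 ?addr0 => [|m _]; last by rewrite mul0r.
rewrite -det_tr; apply: (determinant_alternate a_a0) => b.
by do 2!rewrite [LHS]mxE [RHS]mxE; rewrite ha ha0.
Qed.

End FlowMatrices.

Section LargeCoefficient.
Variables (R : realType) (n : nat).
Local Notation toR := (map_mx (intr : int -> R)).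

Lemma flow_factor_ge1 (t : R) (j : nat) : (0 < n)%N -> 0 <= t -> (j <= n)%N ->
  1 <= expR t * expR (- t / n%:R) ^+ j.
Proof.
move=> n0 t0 jn; rewrite -expRM_natl -expRD -[leLHS]expR0 ler_expR.
have nR : (0 : R) < n%:R by rewrite ltr0n.
have -> : t + j%:R * (- t / n%:R) = t * (n%:R - j%:R) / n%:R.
  by field; rewrite gt_eqF.
by rewrite divr_ge0 ?mulr_ge0 ?subr_ge0 ?ler_nat// ltW.
Qed.

(** Take a nonzero minor [h0] of [A] and redirect one index [a0] to column 0, the one already sent
    there if any. Then [D (h0 a0)] is a nonzero integer times a factor at least 1, and it is one of
    the coefficients of the new minor. *)
Lemma minor_large_coefficient (t : R) j (A : 'M[int]_(j, n.+1)) :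
  (0 < n)%N -> 0 <= t -> row_free (toR A) -> (0 < j)%N ->
  exists (h : 'I_j -> 'I_n.+1) c0 c,
    (forall y, \det (colsub h (toR A *m flow_mx t y)) = c0 + \sum_m c m * y 0 m) /\
    ((exists m, 1 <= `|c m|) \/ (forall m, c m = 0) /\ 1 <= `|c0|).
Proof.
move=> n0 t0 Afree; case: j A Afree => // j A Afree _.
have jn : (j <= n)%N by have := rank_leq_col (toR A); rewrite (eqP Afree).
have [h0 h0P] := row_free_minor Afree.
have [a0 a0P] : exists a0, forall a, a != a0 -> h0 a != ord0.
  have [[a0 ha0]|noa] := pselect (exists a, h0 a = ord0); last first.
    by exists ord0 => a _; apply/eqP => ha; apply: noa; exists a.
  exists a0 => a aa0; apply: contraNneq h0P => ha.
  rewrite -det_tr; apply/eqP; apply: (determinant_alternate aa0) => b.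
  by do 2!rewrite [LHS]mxE [RHS]mxE; rewrite ha ha0.
pose h := [eta h0 with a0 |-> ord0].
pose D m := expR t * expR (- t / n%:R) ^+ j *
    \det (colsub [eta h with a0 |-> m] (toR A)).
have D_large m : D m != 0 -> 1 <= `|D m|.
  rewrite /D -map_mxsub det_map_mx mulf_eq0 negb_or intr_eq0 => /andP[_ d0].
  rewrite normrM -[leLHS]mulr1; apply: ler_pM => //.
    by apply: le_trans (ler_norm _); exact: flow_factor_ge1.
  by rewrite -intr_norm ler1z -gtz0_ge1 normr_gt0.
have D_neq0 : D (h0 a0) != 0.
  apply: mulf_neq0; first by rewrite gt_eqF// mulr_gt0 ?exprn_gt0 ?expR_gt0.
  have -> : colsub [eta h with a0 |-> h0 a0] (toR A) = colsub h0 (toR A) => //.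
  apply/matrixP => r c; rewrite !mxE /=; by case: eqVneq => [->|].
exists h, (D ord0), (fun m => D (lift ord0 m)); split.
  move=> y; apply: minor_flow_mx => [|a aa0]; first by rewrite /= eqxx.
  by rewrite /= (negPf aa0) a0P.
have [[m Dm]|noD] := pselect (exists m, D (lift ord0 m) != 0).
  by left; exists m; exact: D_large.
have D0 m : D (lift ord0 m) = 0.
  by apply/eqP/negPn/negP => Dm; apply: noD; exists m.
right; split=> //; apply: D_large; move: D_neq0.
by case: (unliftP ord0 (h0 a0)) => [m ->|->//]; rewrite D0 eqxx.
Qed.

End LargeCoefficient.

(** * Measure of the points with a short vector *)

Section ShortVectorMeasure.
Variables (R : realType) (d n l : nat).
Variables (V : set 'rV[R]_d) (f : 'rV[R]_d -> 'rV[R]_n).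
Variables (M : nat) (th kap : R) (Q : 'rV[R]_d * R).
Local Notation X := (pcube Q).
Hypotheses (d0 : (0 < d)%N) (n0 : (0 < n)%N) (M1 : (1 < M)%N)
  (th01 : 0 < th <= 1) (kap0 : 0 < kap) (Q0 : 0 < Q.2).
Hypotheses (fCl : Cl_on l V f) (QV : X `<=` V).
Hypothesis fporous : forall c0 c, porous M X th (affine_comb f c0 c).
Hypothesis fsup : forall c0 c i, exists2 x, X x &
  kap * `|c i| <= `|affine_comb f c0 c x|.

Lemma affine_comb_near c0 c x (a : R) : V x -> `|affine_comb f c0 c x| < a ->
  \forall y \near x, `|affine_comb f c0 c y| < a.
Proof.
move=> Vx lt; pose B : R := 1 + \sum_j `|c j|.
have B0 : 0 < B by rewrite ltr_pwDl// sumr_ge0.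
pose del := (a - `|affine_comb f c0 c x|) / B.
have del0 : 0 < del by rewrite divr_gt0// subr_gt0.
apply: filterS (nbhs_deriv_close Vx fCl del0) => y yx.
rewrite -[affine_comb f c0 c y](subrK (affine_comb f c0 c x)).
apply: le_lt_trans (ler_normD _ _) _; rewrite -ltrBrDr.
have -> : a - `|affine_comb f c0 c x| = B * del by rewrite /del mulrC divfK// gt_eqF.
apply: (@le_lt_trans _ _ ((\sum_j `|c j|) * del)); last by rewrite ltr_pM2r// /B ltrDr.
rewrite /affine_comb opprD addrACA subrr add0r -sumrB mulr_suml.
apply: le_trans (ler_norm_sum _ _ _) _; apply: ler_sum => j _.
by rewrite -mulrBr normrM ler_wpM2l//; exact: (yx [::] j).
Qed.

Let G (t : R) (x : 'rV[R]_d) := flow_mx t (f x).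
Let rho := Num.min 1 kap.

(** With the threshold [th ^+ N * rho] for [eps], a vector shorter than [w] cannot exist at a marked
    point, and [measure_unmarked] applies with the sublevel proportion [tau R d M ^+ N] given by
    porosity. *)
Lemma short_vector_measure (t w : R) (N : nat) : 0 <= t ->
  n.+1%:R * w <= th ^+ N * rho ->
  (lebesgue_d [set x | X x /\ in_Omega w (gt n t *m Ly (f x))] <=
    ((flag_const d M n.+1)%:R * tau R d M ^+ N * Q.2 ^+ d)%:E)%E.
Proof.
move=> t0 wN; case/andP: th01 => th0 th1.
have rho0 : 0 < rho by rewrite lt_min ltr01.
have rho1 : rho <= 1 by rewrite ge_min lexx.
have eps_rho : th ^+ N * rho <= rho.
  by rewrite ler_piMl ?(ltW rho0)// exprn_ile1// ltW.
pose P (s : {j & 'M[int]_(j, n.+1)}) := reduced_latt R s /\ (0 < tag s)%N.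
have minorE (s : {j & 'M[int]_(j, n.+1)}) (h : 'I_(tag s) -> 'I_n.+1) :
    exists c0 c, forall x, \det (colsub h (span R s *m G t x)) = affine_comb f c0 c x.
  have [c0 [c cP]] := minor_flow_mx_affine t (span R s) h.
  by exists c0, c => x; exact: cP.
apply: le_trans (le_lebesgue_d (E := X `&` [set x | ~ marked (@tag nat _)
    (@comparable_span R n.+1) (covol (G t)) rho (th ^+ N * rho) x P]) _) _.
  move=> x [Xx [m [m0 mw]]]; split=> // mx.
  pose w' := supnorm (gt n t *m Ly (f x) *m map_mx intr m).
  have : th ^+ N * rho <= n.+1%:R * w'.
    apply: (marked_no_short_vector eps_rho rho1 mx (v := m)) => //.
    - exact: det_flow_mx.
    - exact: bigmax_ge_id.
    - move=> i.
      have -> : (map_mx intr m^T *m G t x) 0 i =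
          (gt n t *m Ly (f x) *m map_mx intr m) i 0.
        by rewrite /G /flow_mx -map_trmx -trmx_mul mxE.
      exact: (le_bigmax _ (fun i => `|(gt n t *m Ly (f x) *m map_mx intr m) i 0|)).
  by apply/negP; rewrite -ltNge (lt_le_trans _ wN)// ltr_pM2l// ltr0n.
apply: (measure_unmarked M1 d0 (@comparable_span R n.+1) (X := X) _ (D := iota 1 n.+1)) => //.
- by rewrite exprn_ge0// tau_ge0.
(* Some minor reaches [rho] at [x]. Where the covolume is below the threshold so is this minor, so
   the sublevel estimate for a single affine combination suffices. *)
- move=> s Q' x _ XQ' Q'x le.
  have [h hP] := maxminor_geP rho0 le.
  have [c0 [c cP]] := minorE s h; rewrite cP in hP.
  apply: le_trans (le_lebesgue_d (E := pcube Q' `&`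
    [set y | (`|affine_comb f c0 c y| < th ^+ N * rho)%R]) _) _.
    move=> y [Q'y lt]; split=> //=; rewrite -cP.
    exact: le_lt_trans (le_maxminor _ h) lt.
  apply: (porous_sublevel M1 d0 _ (fporous c0 c) XQ' Q'x); first by rewrite (ltW th0).
  by rewrite ler_wpM2l// exprn_ge0// ltW.
- move=> s x _ Xx lt.
  have H : \forall y \near nbhs x, forall h : {ffun 'I_(tag s) -> 'I_n.+1},
      `|\det (colsub h (span R s *m G t y))| < rho.
    apply: filter_forall => h; have [c0 [c cP]] := minorE s h.
    have : `|affine_comb f c0 c x| < rho.
      by rewrite -cP; exact: le_lt_trans (le_maxminor _ h) lt.
    by move=> /(affine_comb_near (QV Xx)); apply: filterS => y; rewrite cP.
  have [r /andP[r0 _] rP] := nbhs_ccube H; exists r => // y xy.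
  have Hy : forall h : {ffun 'I_(tag s) -> 'I_n.+1},
      `|\det (colsub h (span R s *m G t y))| < rho.
    apply: rP => i; have := xy i; rewrite ler_norml /= !mxE mulr2n => ?; lra.
  by apply: bigmax_lt => // h _; exact: Hy.
- by rewrite size_iota.
- move=> s [[/eqP sfree _] s0]; rewrite mem_iota s0 add1n ltnS.
  by rewrite -[tag s]sfree rank_leq_col.
- by split.
(* The large coefficient either multiplies a component of [f], and [fsup] gives the point, or is the
   value of a constant minor, and any point will do. *)
- move=> [j A] [[Afree _] /= j0].
  have [h [c0 [c [cP cl]]]] := minor_large_coefficient n0 t0 Afree j0.
  have cov x : `|affine_comb f c0 c x| <= covol (G t) (Tagged _ A) x.
    by rewrite /affine_comb -cP; exact: le_maxminor.
  case: cl => [[m cm]|[c_eq0 c0_large]].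
    have [x Xx xP] := fsup c0 c m; exists x => //; apply: le_trans (cov x).
    apply: le_trans xP; rewrite -[rho]mulr1; apply: ler_pM => //; first exact: ltW.
    by rewrite ge_min lexx orbT.
  exists Q.1; first by move=> i; rewrite lexx lerDl ltW.
  apply: le_trans (cov _); rewrite /affine_comb big1 ?addr0; last first.
    by move=> m _; rewrite c_eq0 mul0r.
  exact: le_trans rho1 c0_large.
Qed.

End ShortVectorMeasure.

(** * Summation *)

Section Summation.
Variable R : realType.

Lemma bernoulli_sub (a : R) (q : nat) : 0 <= a <= 1 -> 1 - q%:R * a <= (1 - a) ^+ q.
Proof.
move=> /andP[a0 a1]; elim: q => [|q IH]; first by rewrite mul0r subr0.
rewrite exprSr; apply: (@le_trans _ _ ((1 - q%:R * a) * (1 - a))).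
  have : 0 <= q%:R * a * a by rewrite !mulr_ge0.
  rewrite -[q.+1%:R]natr1; lra.
by rewrite ler_wpM2r// subr_ge0.
Qed.

Lemma geometric_sum_le (a : R) (m : nat) : 0 <= a < 1 ->
  \sum_(0 <= i < m) a ^+ i <= (1 - a)^-1.
Proof.
move=> /andP[a0 a1]; have a1' : 0 < 1 - a by rewrite subr_gt0.
rewrite -[leRHS]mul1r ler_pdivlMr//.
have -> : (\sum_(0 <= i < m) a ^+ i) * (1 - a) = 1 - a ^+ m.
  elim: m => [|m IH]; first by rewrite big_geq// mul0r expr0 subrr.
  by rewrite big_nat_recr//= mulrDl IH exprSr; ring.
by rewrite lerBlDr lerDl exprn_ge0.
Qed.

(* With [s = 1 - (1 - a) / (2 q)], Bernoulli gives [a <= s ^+ q], which turns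
   the sum into a geometric one. *)
Lemma step_geometric_sum (a : R) (q c : nat) : 0 <= a < 1 -> (0 < q)%N ->
  exists C : R, forall m, \sum_(1 <= t < m) a ^+ (t %/ q - c) <= C.
Proof.
move=> /andP[a0 a1] q0; have qR : (0 : R) < q%:R by rewrite ltr0n.
pose b := (1 - a) / 2 / q%:R.
have bq : q%:R * b = (1 - a) / 2 by rewrite mulrC divfK// gt_eqF.
have b0 : 0 < b by rewrite !divr_gt0// subr_gt0.
have b1 : b <= 1 / 2.
  have : 1 * b <= q%:R * b by rewrite ler_wpM2r ?(ltW b0)// ler1n.
  rewrite bq; lra.
pose s := 1 - b.
have s0 : 0 < s by rewrite /s; lra.
have s1 : s < 1 by rewrite /s; lra.
have as_ : a <= s ^+ q.
  apply: le_trans (bernoulli_sub q _); first by rewrite bq; lra.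
  by apply/andP; split; lra.
have sk0 : 0 < s ^+ (q * c.+1) by rewrite exprn_gt0.
(* [t <= q * (t %/ q - c) + q * c.+1], also when the subtraction truncates to 0; multiplying by
   [s ^+ (q * c.+1)] thus bounds the term of index [t] by [s ^+ t]. *)
exists ((1 - s)^-1 / s ^+ (q * c.+1)) => m.
rewrite ler_pdivlMr//.
apply: le_trans (geometric_sum_le m _); last by rewrite (ltW s0).
apply: (@le_trans _ _ (\sum_(1 <= t < m) s ^+ t)); last first.
  case: m => [|m]; first by rewrite !big_geq.
  by rewrite [leRHS]big_ltn// lerDr.
rewrite mulr_suml; apply: ler_sum => t _.
apply: (@le_trans _ _ (s ^+ (q * (t %/ q - c)) * s ^+ (q * c.+1))).
  by rewrite ler_wpM2r ?(ltW sk0)// exprM lerXn2r ?nnegrE ?exprn_ge0 ?(ltW s0).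
rewrite -exprD; apply: ler_wiXn2l; rewrite ?(ltW s0) ?(ltW s1)//.
rewrite -mulnDr; apply: (@leq_trans (q * (t %/ q).+1)).
  by rewrite mulnC ltnW// ltn_ceil.
by rewrite leq_pmul2l// addnS ltnS addnC -leq_subLR.
Qed.

Lemma expR_small (a gamma : R) : 0 < a -> 0 < gamma ->
  exists2 q : nat, (0 < q)%N & expR (- gamma * q%:R) <= a.
Proof.
move=> a0 g0; exists (Num.truncn (a^-1 / gamma)).+1 => //.
set q := (Num.truncn _).+1.
rewrite mulNr expRN -[a]invrK lef_pV2 ?posrE ?expR_gt0 ?invr_gt0//.
apply: le_trans (expR_ge1Dx _); apply: ler_wpDl => //.
by rewrite mulrC -ler_pdivrMr// ltW// truncnS_gt.
Qed.

End Summation.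

Theorem theorem4p3 (R : realType) (d n l : nat) (hn : (0 < n)%N)
  (V : set 'rV[R]_d) (f : 'rV[R]_d -> 'rV[R]_n) (x0 : 'rV[R]_d) :
  open V -> V x0 -> Cl_on l V f -> nondegenerate_at l f x0 ->
  exists B : set 'rV[R]_d, nbhs x0 B /\ B `<=` V /\
    forall gamma : R, 0 < gamma ->
      (\sum_(1 <= t <oo)
         lebesgue_d [set x | B x /\
            in_Omega (expR (- gamma * t%:R)) (gt n t%:R *m Ly (f x))] < +oo)%E.
Proof.
move=> oV Vx0 fCl fnd.
have [M [th [r [kap [[d0 M1 th01 r0 kap0] XV fporous fsup]]]]] :=
  affine_comb_porous hn oV Vx0 fCl fnd.
exists (pcube (ccube x0 r)); split; first exact: ccube_nbhs.
split=> // gamma g0.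
have Q0 : 0 < (ccube x0 r).2 by rewrite /= mulrn_wgt0.
case/andP: (th01) => th0 th1.
pose rho := Num.min 1 kap.
have rho0 : 0 < rho by rewrite lt_min ltr01.
have nR : (0 : R) < n.+1%:R by rewrite ltr0n.
(* [q] steps of the flow pay for one factor [th], and [c] further steps for [rho / n.+1%:R]; hence
   [N = t %/ q - c] is admissible in [short_vector_measure] once [t %/ q > c]. *)
have [q q0 qth] := expR_small th0 g0.
have [c _ crho] := expR_small (divr_gt0 rho0 nR) g0.
pose K : R := (flag_const d M n.+1)%:R * (ccube x0 r).2 ^+ d + (ccube x0 r).2 ^+ d.
have K0 : 0 <= K by rewrite addr_ge0 ?mulr_ge0// exprn_ge0// ltW.
have t0 := tau_ge0 R d M1.
have t1 := tau_lt1 R d M1.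
have vol0 : 0 <= (ccube x0 r).2 ^+ d by rewrite exprn_ge0// ltW.
have bound t : (lebesgue_d [set x | pcube (ccube x0 r) x /\
    in_Omega (expR (- gamma * t%:R)) (gt n t%:R *m Ly (f x))] <=
    (K * tau R d M ^+ (t %/ q - c))%:E)%E.
  (* For the first values of [t] the truncated exponent is 0, and the volume of the whole cube, the
     second summand of [K], is a sufficient bound. *)
  have [tc|ct] := leqP (t %/ q) c.
    apply: le_trans (le_lebesgue_d (E := pcube (ccube x0 r)) _) _; first by move=> x [].
    apply: le_trans (lebesgue_d_cube _ d0 (ltW Q0)) _.
    by rewrite (eqP tc) expr0 mulr1 lee_fin lerDr mulr_ge0.
  have := short_vector_measure d0 hn M1 th01 kap0 Q0 fCl XV fporous fsup
    (t := t%:R) (w := expR (- gamma * t%:R)) (N := t %/ q - c).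
  move=> /(_ (ler0n _ _)) H; apply: le_trans (H _) _; last first.
    rewrite lee_fin mulrAC ler_wpM2r ?exprn_ge0// /K lerDl.
    exact: vol0.
  rewrite mulrC -ler_pdivlMr//.
  apply: (@le_trans _ _ (expR (- gamma * q%:R) ^+ (t %/ q - c) * expR (- gamma * c%:R))).
    rewrite -expRM_natl -expRD ler_expR mulrCA -!mulrDr !mulNr lerN2 ler_pM2l//.
    rewrite -natrM -natrD ler_nat.
    apply: leq_trans (leq_trunc_div t q).
    rewrite mulnBl; apply: (@leq_trans (t %/ q * q - c * q + c * q)).
      by rewrite leq_add2l leq_pmulr.
    by rewrite subnK// leq_mul2r (ltnW ct) orbT.
  rewrite -mulrA; apply: ler_pM; rewrite ?exprn_ge0 ?expR_ge0//.
  by rewrite lerXn2r ?nnegrE ?expR_ge0 ?(ltW th0).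
have [C CP] := @step_geometric_sum R (tau R d M) q c (introT andP (conj t0 t1)) q0.
apply: (@le_lt_trans _ _ (K * C)%:E); last exact: ltry.
apply: lime_le.
  by apply: is_cvg_nneseries => t _ _; exact: lebesgue_d_ge0.
apply: nearW => m.
apply: (@le_trans _ _ (\sum_(1 <= t < m) (K * tau R d M ^+ (t %/ q - c))%:E)%E).
  by apply: lee_sum => t _; exact: bound.
by rewrite sumEFin lee_fin -mulr_sumr ler_wpM2l.
Qed.
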